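(* Let $w\in S_n$ be $321$-avoiding. Then for every $\gamma\in\mathbb{Z}_{\geq0}^n$, $$g_{w,\gamma}=\#\mathrm{KKoh}(w,\gamma)=\#\widetilde{\mathrm{KKoh}}(w,\gamma),$$ and consequently $$\mathfrak G_w=\sum_{D\in\mathrm{KKoh}(D(w))}(-1)^{\#D-\ell(w)}x^{\mathrm{wt}(D)}=\sum_{D\in\widetilde{\mathrm{KKoh}}(D(w))}(-1)^{\#D-\ell(w)}x^{\mathrm{wt}(D)}.$$
   Context: $w\in S_n$ is $321$-avoiding if there are no $a<b<c$ with $w(a)>w(b)>w(c)$. $\ell$ is Coxeter length, $s_i$ the simple transposition. Grothendieck polynomials: $\mathfrak G_{w_0}=x_1^{n-1}x_2^{n-2}\cdots x_{n-1}$ for $w_0=n\,n-1\cdots 1$, and $\mathfrak G_w=\partial_i((1-x_{i+1})\mathfrak G_{ws_i})$ whenever $w(i)<w(i+1)$, where $\partial_i f=(f-s_if)/(x_i-x_{i+1})$. Grid conventions: $[n]=\{1,\dots,n\}$; box $(i,j)$ is in row $i$, column $j$, $(1,1)$ northwest, rows increase southward. For $P\subseteq[n]\times[n]$, $\mathrm{wt}(P)_i=\#\{c:(i,c)\in P\}$, $\#P$ its cardinality. Pipe dreams: label box $(i,k)$ by $i+k-1$; $\mathrm{word}(P)=(i_1,\dots,i_j)$ reads labels of boxes of $P$ right to left along rows, top row to bottom row. In the 0-Hecke monoid, $e_ue_{s_i}=e_{us_i}$ if $\ell(us_i)>\ell(u)$ and $e_u$ otherwise; the Demazure product $\delta(P)$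 satisfies $e_{s_{i_1}}\cdots e_{s_{i_j}}=e_{\delta(P)}$. Define $g_{w,\gamma}=\#\{P\subseteq[n]\times[n]:\delta(P)=w,\ \mathrm{wt}(P)=\gamma\}$. Diagrams: a labeled diagram is $D\subseteq[n]\times[n]$ whose boxes are labeled ''black'' or ''ghost''; $\mathrm{wt}(D)_i$ counts all boxes in row $i$, $\#D$ is the total number of boxes. Rothe diagram: $D(w)=\{(i,j): w_i>j,\ w^{-1}_j>i\}$. For $(i,j)\in D$ rightmost in row $i$, let $i'=\max\{r\in[i]:(r,j)\notin D\}$ (required to exist). (1) If $(i,j)$ and all $(r,j)$ with $i'+1\le r\le i$ are black: the Kohnert move outputs $D\setminus\{(i,j)\}\cup\{(i',j)\}$ with $(i',j)$ black; the K-Kohnert move outputs $D\cup\{(i',j)\}$ with $(i',j)$ black and $(i,j)$ relabeled ghost. (2) If $(i,j)$ and all $(r,j)$ with $i'+1\le r\le i$ are ghost: the ghost Kohnert move outputs $D\setminus\{(i,j)\}\cup\{(i',j)\}$ with $(i',j)$ ghost; the ghost K-Kohnert move outputs $D\cup\{(i',j)\}$ with $(i',j)$ ghost. $\mathrm{KKoh}(D)$ is the set of labeled diagrams obtainable from $D$ (all boxes initially black) by successive Kohnert and K-Kohnert moves; $\widetilde{\mathrm{KKoh}}(D)$ is the set obtainable by successive Kohnert, K-Kohnert, ghost Kohnert and ghost K-Kohnert moves. $\mathrm{KKoh}(w,\gamma)=\{D\in\mathrm{KKoh}(D(w)):\mathrm{wt}(D)=\gamma\}$ and $\widetilde{\mathrm{KKoh}}(w,\gamma)=\{D\in\widetilde{\mathrm{KKoh}}(D(w)):\mathrm{wt}(D)=\gamma\}$.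 *)

(* Defs.v *)
From HB Require Import structures.
From mathcomp Require Import all_boot all_order all_fingroup all_algebra.
From mathcomp.multinomials Require Import mpoly.
From mathcomp Require Import zify ring.

Set Implicit Arguments.
Unset Strict Implicit.
Unset Printing Implicit Defensive.

Import GRing.Theory.

Local Open Scope ring_scope.

(* Everything is indexed from 0: rows, columns, variables, and the positions and
   values of permutations are shifted down by 1. *)

Section Simple.
Variable m : nat.
Implicit Types (i j : 'I_m.-1) (u : 'S_m).

Fact sright_subproof i : (i.+1 < m)%N.
Proof. by have := ltn_ord i; lia. Qed.

Definition sleft i : 'I_m := widen_ord (leq_pred m) i.
Definition sright i : 'I_m := Ordinal (sright_subproof i).

Definition simple i : 'S_m := tperm (sleft i) (sright i).

(* The product u s_i, i.e. x |-> u (s_i x): the group law of 'S_m is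
   (s * t) x = t (s x), so s_i is written on the left. *)
Definition rmul_simple u i : 'S_m := (simple i * u)%g.

Definition simple_prod (s : seq 'I_m.-1) : 'S_m := foldl rmul_simple 1%g s.

Definition ninv u : nat :=
  #|[set p : 'I_m * 'I_m | (p.1 < p.2)%N && (u p.2 < u p.1)%N]|.

Lemma rmul_simpleE u i x : rmul_simple u i x = u (simple i x).
Proof. by rewrite /rmul_simple permM. Qed.

Lemma rmul_simpleK u i : rmul_simple (rmul_simple u i) i = u.
Proof. by apply/permP => x; rewrite !rmul_simpleE /simple tpermK. Qed.

Lemma sleft_neq_sright i : sleft i != sright i.
Proof. by rewrite -val_eqE /=; lia. Qed.

Lemma simple_comm i j : (i.+1 < j)%N -> (simple i * simple j = simple j * simple i)%g.
Proof.
move=> ij; rewrite conjgC; congr (_ * _)%g; rewrite /simple tpermJ.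
by congr tperm; rewrite tpermD // -val_eqE /=; lia.
Qed.

Lemma simple_braid i j : (j = i.+1 :> nat)%N ->
  (simple i * simple j * simple i = simple j * simple i * simple j)%g.
Proof.
move=> ij; have e : sleft j = sright i by apply: val_inj.
transitivity (simple j ^ simple i)%g.
  by rewrite conjgE {3}/simple tpermV -/(simple i) mulgA.
transitivity (simple i ^ simple j)%g; last first.
  by rewrite conjgE {1}/simple tpermV -/(simple j) mulgA.
have nl : sleft i != sright j by rewrite -val_eqE /=; lia.
rewrite /simple !tpermJ e tpermR tpermL.
rewrite [tperm (sleft i) (sright i) (sright j)]tpermD ?[tperm (sright i) (sright j) (sleft i)]tpermD //.
all: by rewrite -val_eqE /=; lia.
Qed.

Lemma ninv_asc u i : (u (sleft i) < u (sright i))%N ->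
  ninv (rmul_simple u i) = (ninv u).+1.
Proof.
move=> asc; rewrite /ninv.
pose f (p : 'I_m * 'I_m) := (simple i p.1, simple i p.2).
have fK : cancel f f by move=> [a b]; rewrite /f /simple /= !tpermK.
set I1 := [set p | _]; set I0 := [set p | _].
have -> : I1 = (sleft i, sright i) |: (f @: I0).
  apply/setP => -[a b]; rewrite in_setU1.
  have -> : ((a, b) \in f @: I0) = (f (a, b) \in I0).
    by rewrite -{1}[(a, b)]fK (mem_imset _ _ (can_inj fK)).
  rewrite !inE /= !rmul_simpleE xpair_eqE.
  have sl : simple i (sleft i) = sright i by rewrite /simple tpermL.
  have sr : simple i (sright i) = sleft i by rewrite /simple tpermR.
  have [->|na] := eqVneq a (sleft i).
    have [->|nb] := eqVneq b (sright i).
      by rewrite sl sr /=; move: asc; lia.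
    rewrite /= sl; case: (eqVneq b (sleft i)) => [->|nb'].
      by rewrite sl /=; lia.
    have -> : simple i b = b by rewrite /simple tpermD // eq_sym.
    by congr (_ && _); move: nb nb'; rewrite -!val_eqE /=; lia.
  rewrite /=; have [->|na'] := eqVneq a (sright i).
    rewrite sr; case: (eqVneq b (sleft i)) => [->|nb].
      by rewrite sl /=; move: asc; lia.
    case: (eqVneq b (sright i)) => [->|nb']; first by rewrite sr /=; lia.
    have -> : simple i b = b by rewrite /simple tpermD // eq_sym.
    by congr (_ && _); move: nb nb'; rewrite -!val_eqE /=; lia.
  have -> : simple i a = a by rewrite /simple tpermD // eq_sym.
  congr (_ && _); case: (eqVneq b (sleft i)) => [->|nb].
    by rewrite sl; move: na na'; rewrite -!val_eqE /=; lia.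
  case: (eqVneq b (sright i)) => [->|nb'].
    by rewrite sr; move: na na'; rewrite -!val_eqE /=; lia.
  by have -> : simple i b = b by rewrite /simple tpermD // eq_sym.
rewrite cardsU1 (card_imset _ (can_inj fK)) -[X in X \in _]fK.
rewrite (mem_imset _ _ (can_inj fK)) inE /=.
by rewrite /simple tpermL tpermR /= ltnNge leqnSn.
Qed.

Lemma ninv_desc u i : (u (sright i) < u (sleft i))%N ->
  ninv u = (ninv (rmul_simple u i)).+1.
Proof.
move=> d; rewrite -{1}[u](rmul_simpleK u i) ninv_asc // !rmul_simpleE.
by rewrite /simple tpermL tpermR.
Qed.

Lemma asc_or_desc u i :
  (u (sleft i) < u (sright i))%N \/ (u (sright i) < u (sleft i))%N.
Proof.
have : u (sleft i) != u (sright i) by rewrite (inj_eq perm_inj) sleft_neq_sright.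
by rewrite -val_eqE /=; lia.
Qed.

Lemma ninv1 : ninv 1%g = 0%N.
Proof.
by apply/eqP; rewrite cards_eq0; apply/eqP/setP => p; rewrite !inE !perm1; lia.
Qed.

Lemma no_desc u : (forall i, (u (sleft i) < u (sright i))%N) -> u = 1%g.
Proof.
move=> mon.
have mono k : forall a b : 'I_m, (b = a + k.+1 :> nat)%N -> (u a < u b)%N.
  elim: k => [|k IH] a b eb.
    have ai : (a < m.-1)%N by have := ltn_ord b; lia.
    have := mon (Ordinal ai).
    have -> : sleft (Ordinal ai) = a by apply: val_inj.
    by have -> : sright (Ordinal ai) = b by apply: val_inj => /=; lia.
  have ai : (a < m.-1)%N by have := ltn_ord b; lia.
  apply: ltn_trans (IH (sright (Ordinal ai)) b _); last by rewrite /=; lia.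
  have := mon (Ordinal ai).
  by have -> : sleft (Ordinal ai) = a by apply: val_inj.
have lt (a b : 'I_m) : (a < b)%N -> (u a < u b)%N.
  by move=> ab; apply: (mono (b - a).-1); lia.
have ge (a : 'I_m) : (a <= u a)%N.
  case: a => k; elim: k => [//|k IH] km.
  have km' : (k < m)%N by lia.
  by have := IH km'; have := lt (Ordinal km') (Ordinal km) (ltnSn k) => /=; lia.
have gei k (a : 'I_m) : (k <= m - a)%N -> (m - k <= a)%N -> (u a <= a)%N.
  elim: k a => [|k IH] a k1 k2; first by have := ltn_ord a; lia.
  case: (leqP (m - k) a) => ak; first by apply: IH => //; lia.
  case: (ltnP a.+1 m) => am; last by have := ltn_ord (u a); lia.
  have := IH (Ordinal am); have := lt a (Ordinal am) (ltnSn a) => /=; lia.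
apply/permP => a; rewrite perm1; apply: val_inj; apply/eqP.
rewrite eqn_leq ge andbT; apply: (gei (m - a)%N) => //.
by have := ltn_ord a; lia.
Qed.

Lemma ninv_word u : exists2 s, size s = ninv u & simple_prod s = u.
Proof.
have [k] := ubnP (ninv u); elim: k u => // k IH u ku.
case: (pickP (fun i => u (sright i) < u (sleft i))%N) => [i di|nd].
  have e := ninv_desc di.
  have [|s ss su] := IH (rmul_simple u i); first by lia.
  exists (rcons s i); first by rewrite size_rcons ss e.
  by rewrite /simple_prod foldl_rcons -/(simple_prod s) su rmul_simpleK.
have -> : u = 1%g.
  by apply: no_desc => i; have := nd i; case: (asc_or_desc u i) => // ->.
by exists [::]; rewrite ?ninv1.
Qed.

Lemma ninv_simple_prod s : (ninv (simple_prod s) <= size s)%N.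
Proof.
elim/last_ind: s => [|s i IH]; first by rewrite /simple_prod /= ninv1.
rewrite /simple_prod foldl_rcons -/(simple_prod s) size_rcons.
by case: (asc_or_desc (simple_prod s) i) => [/ninv_asc|/ninv_desc]; lia.
Qed.

Fact has_word u : exists k : nat, [exists s : k.-tuple 'I_m.-1, simple_prod s == u].
Proof.
have [s _ su] := ninv_word u; exists (size s).
by apply/existsP; exists (in_tuple s); rewrite su.
Qed.

Definition coxlen u : nat := ex_minn (has_word u).

Lemma coxlenE u : coxlen u = ninv u.
Proof.
rewrite /coxlen; case: ex_minnP => k /existsP[t /eqP tu] kmin.
apply/eqP; rewrite eqn_leq; apply/andP; split.
  have [s ss su] := ninv_word u; rewrite -ss; apply: kmin.
  by apply/existsP; exists (in_tuple s); rewrite su.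
by rewrite -tu (leq_trans (ninv_simple_prod t)) ?size_tuple.
Qed.

End Simple.

Definition avoids321 (n : nat) (w : 'S_n) : Prop :=
  ~ exists a b c : 'I_n,
      [/\ (a < b)%N, (b < c)%N, (w b < w a)%N & (w c < w b)%N].

Section BraidAlgebra.
Variable R : idomainType.
Implicit Types x y z t : R.

Fact comm_alg x y z t (f sf rf srf A B sB rA AB BA : R) :
  x - y != 0 -> z - t != 0 ->
  (x - y) * A = (1 - y) * f - (1 - x) * sf ->
  (z - t) * B = (1 - t) * f - (1 - z) * rf ->
  (z - t) * sB = (1 - t) * sf - (1 - z) * srf ->
  (x - y) * rA = (1 - y) * rf - (1 - x) * srf ->
  (x - y) * AB = (1 - y) * B - (1 - x) * sB ->
  (z - t) * BA = (1 - t) * A - (1 - z) * rA ->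
  AB = BA.
Proof.
move=> xy zt eA eB esB erA eAB eBA.
apply: (mulfI xy); apply: (mulfI zt).
transitivity ((1 - y) * ((z - t) * B) - (1 - x) * ((z - t) * sB)).
  by rewrite eAB; ring.
transitivity ((1 - t) * ((x - y) * A) - (1 - z) * ((x - y) * rA)).
  by rewrite eA eB esB erA; ring.
transitivity ((x - y) * ((z - t) * BA)); last by ring.
by rewrite eBA; ring.
Qed.

Fact sym_alg x y (f sf A sA : R) : x - y != 0 ->
  (x - y) * A = (1 - y) * f - (1 - x) * sf ->
  (y - x) * sA = (1 - x) * sf - (1 - y) * f -> sA = A.
Proof.
move=> xy eA esA; apply: (mulfI xy); rewrite eA.
by transitivity (- ((y - x) * sA)); [ring | rewrite esA; ring].
Qed.

Fact braid_alg x y z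
  (f sf tf stf tsf tstf A B tA sB stA tsB AB BA tAB sBA ABA BAB : R) :
  x - y != 0 -> x - z != 0 -> y - z != 0 ->
  (x - y) * A = (1 - y) * f - (1 - x) * sf ->
  (y - z) * B = (1 - z) * f - (1 - y) * tf ->
  (x - z) * sB = (1 - z) * sf - (1 - x) * stf ->
  (x - z) * tA = (1 - z) * tf - (1 - x) * tsf ->
  (x - y) * tsB = (1 - y) * tsf - (1 - x) * tstf ->
  (y - z) * stA = (1 - z) * stf - (1 - y) * tstf ->
  (x - y) * AB = (1 - y) * B - (1 - x) * sB ->
  (y - z) * BA = (1 - z) * A - (1 - y) * tA ->
  (x - z) * tAB = (1 - z) * B - (1 - x) * tsB ->
  (x - z) * sBA = (1 - z) * A - (1 - x) * stA ->
  (x - y) * ABA = (1 - y) * BA - (1 - x) * sBA ->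
  (y - z) * BAB = (1 - z) * AB - (1 - y) * tAB ->
  ABA = BAB.
Proof.
move=> xy xz yz eA eB esB etA etsB estA eAB eBA etAB esBA eABA eBAB.
apply: (mulfI xy); apply: (mulfI xz); apply: (mulfI yz).
transitivity ((1 - z) ^+ 2 * ((x - y) * A) - (1 - y) ^+ 2 * ((x - z) * tA)
    + (1 - x) ^+ 2 * ((y - z) * stA)).
  transitivity ((1 - y) * (x - z) * ((y - z) * BA)
      - (1 - x) * (y - z) * ((x - z) * sBA)); first by rewrite eABA; ring.
  by rewrite eBA esBA; ring.
transitivity ((1 - z) * (1 - y) * ((y - z) * B)
    - (1 - z) * (1 - x) * ((x - z) * sB)
    + (1 - y) * (1 - x) * ((x - y) * tsB)).
  by rewrite eA eB etA estA esB etsB; ring.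
transitivity ((x - y) * ((x - z) * ((y - z) * BAB))); last by ring.
rewrite eBAB.
transitivity ((1 - z) * (x - z) * ((x - y) * AB)
    - (1 - y) * (x - y) * ((x - z) * tAB)); last by ring.
by rewrite eAB etAB; ring.
Qed.

End BraidAlgebra.

Section Grothendieck.
Variable n : nat.
Implicit Types (i j : 'I_n.-1) (f g : {mpoly int[n]}) (w : 'S_n).

Lemma msym_tpermX (s : 'S_n) (k : 'I_n) : msym s ('X_k : {mpoly int[n]}) = 'X_(s k).
Proof.
rewrite msymX; congr mpolyX; apply/mnmP => l.
rewrite mnmE !mnm1E; congr nat_of_bool.
by apply/eqP/eqP => [->|<-]; rewrite ?permKV ?permK.
Qed.

Lemma msym_simpleL i : msym (simple i) ('X_(sleft i) : {mpoly int[n]}) = 'X_(sright i).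
Proof. by rewrite msym_tpermX /simple tpermL. Qed.

Lemma msym_simpleR i : msym (simple i) ('X_(sright i) : {mpoly int[n]}) = 'X_(sleft i).
Proof. by rewrite msym_tpermX /simple tpermR. Qed.

Fact ddiff_exists i f :
  exists q : {mpoly int[n]},
    ('X_(sleft i) - 'X_(sright i)) * q == f - msym (simple i) f.
Proof.
pose D : {mpoly int[n]} := 'X_(sleft i) - 'X_(sright i).
pose P f := exists q, D * q == f - msym (simple i) f.
have PM g h : P g -> P h -> P (g * h).
  move=> [a /eqP ha] [b /eqP hb]; exists (a * h + msym (simple i) g * b).
  apply/eqP; rewrite msymM.
  transitivity ((D * a) * h + msym (simple i) g * (D * b)); first by ring.
  by rewrite ha hb; ring.
have PX (k : 'I_n) : P 'X_k.
  rewrite /P msym_tpermX /simple; case: tpermP => [->|->|_ _].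
  - by exists 1; rewrite mulr1.
  - by exists (-1); rewrite mulrN1 opprB.
  - by exists 0; rewrite mulr0 subrr.
have P1 : P 1 by exists 0; rewrite mulr0 msym1 subrr.
have PXm m : P 'X_[m].
  rewrite mpolyXE_id; apply: (big_ind P) => // k _.
  elim: (m k) => [|e IH]; first by rewrite expr0.
  by rewrite exprS; apply: PM.
elim/mpolyind: f => [|c m p _ _ [q /eqP hq]].
  by exists 0; rewrite mulr0 msym0 subrr.
have [r /eqP hr] := PXm m; exists (c *: r + q); apply/eqP.
rewrite mulrDr -scalerAr [_ * r]hr hq msymD msymZ scalerBr.
by rewrite opprD addrACA.
Qed.

(* (f - s_i f) / (x_i - x_{i+1}); the quotient is unique, {mpoly int[n]} being
   an integral domain. *)
Definition ddiff i f : {mpoly int[n]} := xchoose (ddiff_exists i f).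

Lemma ddiffE i f :
  ('X_(sleft i) - 'X_(sright i)) * ddiff i f = f - msym (simple i) f.
Proof. exact/eqP/(xchooseP (ddiff_exists i f)). Qed.

Definition w0 : 'S_n := perm (@rev_ord_inj n).

Definition is_grothendieck (G : {ffun 'S_n -> {mpoly int[n]}}) : bool :=
  (G w0 == \prod_(i < n) 'X_i ^+ (n - i.+1))
  && [forall w : 'S_n, forall i : 'I_n.-1,
        (w (sleft i) < w (sright i))%N
        ==> (G w == ddiff i ((1 - 'X_(sright i)) * G (rmul_simple w i)))].

(* The recursion is consistent because the operators
   f |-> ddiff i ((1 - x_{i+1}) f) satisfy the braid relations. *)

Section Consistency.
Variable op : 'I_n.-1 -> {mpoly int[n]} -> {mpoly int[n]}.
Hypothesis opE : forall i f, ('X_(sleft i) - 'X_(sright i)) * op i f =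
  (1 - 'X_(sright i)) * f - (1 - 'X_(sleft i)) * msym (simple i) f.
Variable start : {mpoly int[n]}.

Let mpolyX_sub_neq0 (a b : 'I_n) : a != b -> ('X_a - 'X_b : {mpoly int[n]}) != 0.
Proof.
move=> ab; rewrite subr_eq0; apply/negP => /eqP /(congr1 (mcoeff U_(a))).
rewrite !mcoeffXU eqxx eq_sym (negPf ab).
by move/eqP.
Qed.

Let msym_eq (r : 'S_n) (x y g h k : {mpoly int[n]}) :
  (x - y) * g = (1 - y) * h - (1 - x) * k ->
  (msym r x - msym r y) * msym r g
    = (1 - msym r y) * msym r h - (1 - msym r x) * msym r k.
Proof.
move/(congr1 (msym r)); rewrite [msym r (_ - _)]msymB !msymM.
by rewrite (msymB r x) (msymB r 1 y) (msymB r 1 x) msym1.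
Qed.

Let op_comm i j f : (i.+1 < j)%N -> op i (op j f) = op j (op i f).
Proof.
move=> ij.
have fx k (e : 'I_n) : e != sleft k -> e != sright k ->
    msym (simple k) ('X_e : {mpoly int[n]}) = 'X_e.
  by move=> *; rewrite msym_tpermX /simple tpermD // eq_sym.
set x : {mpoly int[n]} := 'X_(sleft i); set y : {mpoly int[n]} := 'X_(sright i).
set z : {mpoly int[n]} := 'X_(sleft j); set t : {mpoly int[n]} := 'X_(sright j).
set s := simple i; set r := simple j.
have sz : msym s z = z by apply: fx => //; rewrite -val_eqE /=; lia.
have st : msym s t = t by apply: fx => //; rewrite -val_eqE /=; lia.
have rx : msym r x = x by apply: fx => //; rewrite -val_eqE /=; lia.
have ry : msym r y = y by apply: fx => //; rewrite -val_eqE /=; lia.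
have src : msym r (msym s f) = msym s (msym r f).
  rewrite -!msymMm; congr (msym _ f); exact: simple_comm.
have xy : x - y != 0 by apply: mpolyX_sub_neq0; apply: sleft_neq_sright.
have zt : z - t != 0 by apply: mpolyX_sub_neq0; apply: sleft_neq_sright.
have e1 : (z - t) * msym s (op j f) =
    (1 - t) * msym s f - (1 - z) * msym s (msym r f).
  by have := msym_eq s (opE j f); rewrite -/z -/t -/r sz st.
have e2 : (x - y) * msym r (op i f) =
    (1 - y) * msym r f - (1 - x) * msym s (msym r f).
  by have := msym_eq r (opE i f); rewrite -/x -/y -/s rx ry src.
exact: (comm_alg xy zt (opE i f) (opE j f) e1 e2 (opE i (op j f)) (opE j (op i f))).
Qed.

Let op_braid i j f : (j = i.+1 :> nat)%N ->
  op i (op j (op i f)) = op j (op i (op j f)).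
Proof.
move=> ij.
have yy : sleft j = sright i by apply: val_inj.
set x : {mpoly int[n]} := 'X_(sleft i); set y : {mpoly int[n]} := 'X_(sright i).
set z : {mpoly int[n]} := 'X_(sright j).
set s := simple i; set t := simple j.
have sx : msym s x = y by exact: msym_simpleL.
have sy : msym s y = x by exact: msym_simpleR.
have ty : msym t y = z by rewrite /y -yy; exact: msym_simpleL.
have tz : msym t z = y by rewrite /y -yy; exact: msym_simpleR.
have sz : msym s z = z.
  by rewrite msym_tpermX /s /simple tpermD // -val_eqE /=; lia.
have tx : msym t x = x.
  by rewrite msym_tpermX /t /simple tpermD // -val_eqE /=; lia.
have br : msym s (msym t (msym s f)) = msym t (msym s (msym t f)).
  rewrite -!msymMm; congr (msym _ f).
  by rewrite !mulgA; apply: simple_braid.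
have xy : x - y != 0 by apply: mpolyX_sub_neq0; rewrite -val_eqE /=; lia.
have yz : y - z != 0 by apply: mpolyX_sub_neq0; rewrite -val_eqE /=; lia.
have xz : x - z != 0 by apply: mpolyX_sub_neq0; rewrite -val_eqE /=; lia.
have A h : (x - y) * op i h = (1 - y) * h - (1 - x) * msym s h by exact: opE.
have B h : (y - z) * op j h = (1 - z) * h - (1 - y) * msym t h.
  by have := opE j h; rewrite yy.
have ss h : msym s (msym s h) = h by rewrite -msymMm /s /simple tperm2 msym1m.
have tt h : msym t (msym t h) = h by rewrite -msymMm /t /simple tperm2 msym1m.
have sA h : msym s (op i h) = op i h.
  have e := msym_eq s (A h); rewrite sx sy ss in e.
  exact: (sym_alg xy (A h) e).
have tB h : msym t (op j h) = op j h.
  have e := msym_eq t (B h); rewrite ty tz tt in e.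
  exact: (sym_alg yz (B h) e).
have sB : (x - z) * msym s (op j f) = (1 - z) * msym s f - (1 - x) * msym s (msym t f).
  by have := msym_eq s (B f); rewrite sy sz.
have tA : (x - z) * msym t (op i f) = (1 - z) * msym t f - (1 - x) * msym t (msym s f).
  by have := msym_eq t (A f); rewrite tx ty.
have tsB : (x - y) * msym t (msym s (op j f)) =
    (1 - y) * msym t (msym s f) - (1 - x) * msym t (msym s (msym t f)).
  by have := msym_eq t sB; rewrite tx tz.
have stA : (y - z) * msym s (msym t (op i f)) =
    (1 - z) * msym s (msym t f) - (1 - y) * msym t (msym s (msym t f)).
  by have := msym_eq s tA; rewrite sx sz br.
have tAB : (x - z) * msym t (op i (op j f)) =
    (1 - z) * op j f - (1 - x) * msym t (msym s (op j f)).
  by have := msym_eq t (A (op j f)); rewrite tx ty tB.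
have sBA : (x - z) * msym s (op j (op i f)) =
    (1 - z) * op i f - (1 - x) * msym s (msym t (op i f)).
  by have := msym_eq s (B (op i f)); rewrite sy sz sA.
exact: (braid_alg xy xz yz (A f) (B f) sB tA tsB stA (A (op j f)) (B (op i f))
  tAB sBA (A (op j (op i f))) (B (op i (op j f)))).
Qed.

Let asc w i := (w (sleft i) < w (sright i))%N.

Let Gf := fix Gf (k : nat) (w : 'S_n) : {mpoly int[n]} :=
  if k is k'.+1 then
    if [pick i | asc w i] is Some i then op i (Gf k' (rmul_simple w i)) else start
  else start.

Let G w := Gf (n * n - ninv w)%N w.

Let ninv_le w : (ninv w <= n * n)%N.
Proof. by rewrite (leq_trans (max_card _)) // card_prod card_ord. Qed.

Let rmulL w i : rmul_simple w i (sleft i) = w (sright i).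
Proof. by rewrite rmul_simpleE /simple tpermL. Qed.

Let rmulR w i : rmul_simple w i (sright i) = w (sleft i).
Proof. by rewrite rmul_simpleE /simple tpermR. Qed.

Let rmulD w i e : e != sleft i -> e != sright i -> rmul_simple w i e = w e.
Proof. by move=> *; rewrite rmul_simpleE /simple tpermD // eq_sym. Qed.

Let G_pick w i : [pick i | asc w i] = Some i -> G w = op i (G (rmul_simple w i)).
Proof.
move=> p; have a : asc w i by move: p; case: pickP => // ? ? [<-].
have e := ninv_asc a; have := ninv_le (rmul_simple w i); rewrite /G e => le.
have -> : (n * n - ninv w = (n * n - (ninv w).+1).+1)%N by lia.
by rewrite /= p.
Qed.

Let G_rec w i : asc w i -> G w = op i (G (rmul_simple w i)).
Proof.
have [k] := ubnP (n * n - ninv w)%N; elim: k w i => // k IH w i wk ai.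
case E : [pick i | asc w i] => [i0|]; last first.
  by move: E; case: pickP => // /(_ i); rewrite ai.
have a0 : asc w i0 by move: E; case: pickP => // ? ? [<-].
rewrite (G_pick E) {E}.
have IHs w' j : (ninv w < ninv w')%N -> asc w' j -> G w' = op j (G (rmul_simple w' j)).
  by move=> lt; apply: IH; have := ninv_le w'; lia.
clear IH wk k.
wlog lt : i i0 ai a0 / (i < i0)%N.
  move=> H; case: (ltngtP i i0) => [lt|lt|/val_inj -> //]; first exact: H.
  by symmetry; apply: H.
have n1 := ninv_asc ai; have n2 := ninv_asc a0.
case: (ltnP i.+1 i0) => far.
  have b1 : asc (rmul_simple w i) i0.
    by rewrite /asc !rmulD // -val_eqE /=; lia.
  have b2 : asc (rmul_simple w i0) i.
    by rewrite /asc !rmulD // -val_eqE /=; lia.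
  rewrite (IHs _ _ _ b1) ?n1 // (IHs _ _ _ b2) ?n2 // -op_comm //.
  by rewrite /rmul_simple !mulgA (simple_comm far).
have adj : (i0 = i.+1 :> nat)%N by lia.
have m0 : sleft i0 = sright i by apply: val_inj.
have lr : sleft i != sleft i0 by rewrite -val_eqE /=; lia.
have lr' : sleft i != sright i0 by rewrite -val_eqE /=; lia.
have rl : sright i0 != sright i by rewrite -val_eqE /=; lia.
have rl' : sright i0 != sleft i by rewrite -val_eqE /=; lia.
have trans : (w (sleft i) < w (sright i0))%N.
  by apply: ltn_trans ai _; rewrite -m0.
have b1 : asc (rmul_simple w i) i0 by rewrite /asc m0 rmulR rmulD.
have b2 : asc (rmul_simple w i0) i by rewrite /asc -m0 rmulL rmulD.
have n3 := ninv_asc b1; have n4 := ninv_asc b2.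
have c1 : asc (rmul_simple (rmul_simple w i) i0) i.
  by rewrite /asc (rmulD _ lr lr') rmulL -m0 rmulL (rmulD _ rl' rl).
have c2 : asc (rmul_simple (rmul_simple w i0) i) i0.
  by rewrite /asc (rmulD _ rl' rl) rmulR m0 rmulR (rmulD _ lr lr').
rewrite (IHs _ _ _ b1) ?n1 // (IHs _ _ _ b2) ?n2 //.
rewrite (IHs _ _ _ c1) ?n3 ?n1 // (IHs _ _ _ c2) ?n4 ?n2 // -op_braid //.
by rewrite /rmul_simple !mulgA (simple_braid adj).
Qed.

Fact consistent : exists G : 'S_n -> {mpoly int[n]}, G w0 = start /\
  forall w i, (w (sleft i) < w (sright i))%N -> G w = op i (G (rmul_simple w i)).
Proof.
exists G; split; last exact: G_rec.
rewrite /G; case: (n * n - _)%N => [//|k] /=.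
by case: pickP => // i; rewrite /asc !permE /=; have := ltn_ord i; lia.
Qed.

End Consistency.

Fact grothendieck_exists : exists G, is_grothendieck G.
Proof.
have opE i f : ('X_(sleft i) - 'X_(sright i)) * ddiff i ((1 - 'X_(sright i)) * f) =
    (1 - 'X_(sright i)) * f - (1 - 'X_(sleft i)) * msym (simple i) f.
  by rewrite ddiffE msymM msymB msym1 msym_simpleR.
have [G [G0 Gr]] := consistent opE (\prod_(i < n) 'X_i ^+ (n - i.+1)).
exists [ffun w => G w]; apply/andP; split; first by rewrite ffunE G0.
apply/forallP => w; apply/forallP => i; apply/implyP => a.
by rewrite !ffunE (Gr _ _ a).
Qed.

(* The family is unique, by descending induction on coxlen w. *)
Definition Grothendieck : {ffun 'S_n -> {mpoly int[n]}} := xchoose grothendieck_exists.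

Lemma Grothendieck_w0 : Grothendieck w0 = \prod_(i < n) 'X_i ^+ (n - i.+1).
Proof. by have /andP[/eqP] := xchooseP grothendieck_exists. Qed.

Lemma Grothendieck_rec w i : (w (sleft i) < w (sright i))%N ->
  Grothendieck w = ddiff i ((1 - 'X_(sright i)) * Grothendieck (rmul_simple w i)).
Proof.
have /andP[_ /forallP/(_ w)/forallP/(_ i)/implyP H] := xchooseP grothendieck_exists.
by move=> a; apply/eqP/H.
Qed.

End Grothendieck.

Section PipeDreams.
Variable n : nat.
Implicit Types (P : {set 'I_n * 'I_n}) (w : 'S_n).

Definition wt P : 'X_{1..n} := [multinom #|[set c | (i, c) \in P]| | i < n].

Fact box_label_subproof (b : 'I_n * 'I_n) : (b.1 + b.2 < (n + n).-1)%N.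
Proof. by have := ltn_ord b.1; have := ltn_ord b.2; lia. Qed.

(* The labels of boxes of [n] x [n] range over 1, ..., 2n-1, so the Demazure
   product is computed in S_{2n}. *)
Definition box_label (b : 'I_n * 'I_n) : 'I_(n + n).-1 :=
  Ordinal (box_label_subproof b).

Definition pd_word P : seq 'I_(n + n).-1 :=
  [seq box_label b
     | b <- [seq (i, k) | i <- enum 'I_n, k <- rev (enum 'I_n)] & b \in P].

Definition hecke_mul m (u : 'S_m) (i : 'I_m.-1) : 'S_m :=
  if (coxlen u < coxlen (rmul_simple u i))%N then rmul_simple u i else u.

Definition demazure P : 'S_(n + n) := foldl (@hecke_mul (n + n)) 1%g (pd_word P).

Definition extend_fun w (x : 'I_(n + n)) : 'I_(n + n) :=
  match split x with
  | inl i => lshift n (w i)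
  | inr i => rshift n i
  end.

Fact extend_inj w : injective (extend_fun w).
Proof.
move=> x y; rewrite -[x]splitK -[y]splitK /extend_fun !unsplitK.
case: (split x) => a; case: (split y) => b /=.
- by move/lshift_inj/perm_inj->.
- by move/eqP; rewrite eq_lrshift.
- by move/eqP; rewrite eq_rlshift.
- by move/rshift_inj->.
Qed.

(* The standard embedding of S_n into S_{2n}. *)
Definition extend w : 'S_(n + n) := perm (@extend_inj w).

Definition gcoef w (gamma : 'X_{1..n}) : nat :=
  #|[set P | (demazure P == extend w) && (wt P == gamma)]|.

End PipeDreams.

Definition label := bool.
Definition black : label := true.
Definition ghost : label := false.

(* None: no box; Some l: a box labeled l. *)
Definition diagram (n : nat) := {ffun 'I_n * 'I_n -> option label}.

Section Diagrams.
Variable n : nat.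
Implicit Types (D E : diagram n) (i j r : 'I_n) (w : 'S_n).

Definition boxes D : {set 'I_n * 'I_n} := [set b | D b != None].

Definition all_black (S : {set 'I_n * 'I_n}) : diagram n :=
  [ffun b => if b \in S then Some black else None].

Definition rothe w : {set 'I_n * 'I_n} :=
  [set b : 'I_n * 'I_n | (b.2 < w b.1)%N && (b.1 < (w^-1)%g b.2)%N].

Definition rightmost D i j : bool :=
  ((i, j) \in boxes D) && [forall c : 'I_n, (j < c)%N ==> ((i, c) \notin boxes D)].

Definition landing D i j i' : bool :=
  [&& (i' <= i)%N, (i', j) \notin boxes D
    & [forall r : 'I_n, (r <= i)%N && ((r, j) \notin boxes D) ==> (r <= i')%N]].

(* The common shape of the four moves: all boxes of column j in rows i'+1, ..., i
   carry the label l; a box labeled l is put at (i', j), and the content of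
   (i, j) becomes left. *)
Definition move (l : label) (left : option label) : rel (diagram n) :=
  fun D E => [exists i : 'I_n, exists j : 'I_n, exists i' : 'I_n,
    [&& rightmost D i j, landing D i j i',
        [forall r : 'I_n, (i' < r <= i)%N ==> (D (r, j) == Some l)]
      & E == [ffun b => if b == (i', j) then Some l
                        else if b == (i, j) then left else D b]]].

Definition kohnert : rel (diagram n) := move black None.
Definition k_kohnert : rel (diagram n) := move black (Some ghost).
Definition ghost_kohnert : rel (diagram n) := move ghost None.
Definition ghost_k_kohnert : rel (diagram n) := move ghost (Some ghost).

Definition KKoh (S : {set 'I_n * 'I_n}) : {set diagram n} :=
  [set E | connect (fun D D' => kohnert D D' || k_kohnert D D') (all_black S) E].

Definition tKKoh (S : {set 'I_n * 'I_n}) : {set diagram n} :=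
  [set E | connect (fun D D' => [|| kohnert D D', k_kohnert D D',
                                    ghost_kohnert D D' | ghost_k_kohnert D D'])
                   (all_black S) E].

Definition KKoh_wt w (gamma : 'X_{1..n}) : {set diagram n} :=
  [set D in KKoh (rothe w) | wt (boxes D) == gamma].

Definition tKKoh_wt w (gamma : 'X_{1..n}) : {set diagram n} :=
  [set D in tKKoh (rothe w) | wt (boxes D) == gamma].

(* (-1)^{#D - l(w)} x^{wt(D)}, with an integer exponent. *)
Definition signed_term w D : {mpoly int[n]} :=
  ((-1 : int) ^ (#|boxes D|%:Z - (coxlen w)%:Z)) *: 'X_[wt (boxes D)].

End Diagrams.

(* Main.v *)
From HB Require Import structures.
Require Import Defs.
From mathcomp Require Import all_boot all_order all_fingroup all_algebra.
From mathcomp.multinomials Require Import mpoly.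
From mathcomp Require Import zify ring.

Set Implicit Arguments.
Unset Strict Implicit.
Unset Printing Implicit Defensive.

Import GRing.Theory.

(* All three families are parametrised by the same set-valued tableaux [T] of the
   Rothe diagram: [T b] is the set of rows of the boxes that descend from the box
   [b], the topmost of them being black and the others ghosts; tableaux are weakly
   decreasing along rows, strictly increasing down columns, and [T (i, j)] lies in
   rows at most [i].  A move replaces one entry, or shifts one entry in each of the
   cells that it jumps over; this preserves tableaux because the Rothe diagram of a
   321-avoiding permutation is a skew shape.  Every tableau is reached, by moving
   entries back down in a suitable order.

   In a word with Demazure product [w] each letter compares two values which are
   inverted in [w], i.e. a box of the Rothe diagram, and for 321-avoiding [w] this
   box determines the letter.  Recording the rows of the letters belonging to each
   box turns a pipe dream into a tableau, and conversely.

   The pipe dream formula for the Grothendieck polynomial follows Fomin and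
   Kirillov: by the Yang-Baxter equation in the 0-Hecke algebra, the product of two
   consecutive rows and one more letter is symmetric in the two row variables,
   which is the divided difference recursion. *)

(* [lia] is very slow when the context contains membership hypotheses. *)
Ltac ord_lia :=
  repeat match goal with H : ?P |- _ =>
    lazymatch P with
    | is_true (leq _ _) => fail
    | is_true (leq _ _ && leq _ _) => fail
    | is_true (~~ leq _ _) => fail
    | is_true (~~ (leq _ _ && leq _ _)) => fail
    | is_true (~~ (_ == _)) => fail
    | not (@eq nat _ _) => fail
    | @eq nat _ _ => fail
    | @eq (ordinal _) _ _ => fail
    | _ => clear H
    end end; lia.

Lemma card_ord_lt m k : k <= m -> #|[set z : 'I_m | z < k]| = k.
Proof. by move=> km; rewrite -sum1dep_card (big_ord_narrow km) sum1_card card_ord. Qed.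

Lemma card_ord_between m (x y : 'I_m) : #|[set z : 'I_m | x < z < y]| = y - x.+1.
Proof.
have -> : [set z : 'I_m | x < z < y] = [set z : 'I_m | z < y] :\: [set z : 'I_m | z < x.+1].
  by apply/setP => z; rewrite !inE -leqNgt.
rewrite cardsD (card_ord_lt (ltnW (ltn_ord y))).
have -> : [set z : 'I_m | z < y] :&: [set z : 'I_m | z < x.+1] =
  [set z : 'I_m | z < minn y x.+1].
  by apply/setP => z; rewrite !inE leq_min.
by rewrite card_ord_lt; have := ltn_ord y; lia.
Qed.

Lemma card_ord_sep_lt m (p : pred 'I_m) (x : 'I_m) a b : p x -> a <= x < b ->
  #|[set z : 'I_m | (z < a) && p z]| < #|[set z : 'I_m | (z < b) && p z]|.
Proof.
move=> px /andP[ax xb]; apply/proper_card/properP; split; last first.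
  by exists x; rewrite !inE px ?xb // andbT -leqNgt.
apply/subsetP => z; rewrite !inE => /andP[za ->].
by rewrite andbT (ltn_trans (leq_trans za ax)).
Qed.

Section Shapes.
Variable n : nat.
Implicit Types (i j : 'I_n) (q : 'I_n * 'I_n) (S : {set 'I_n * 'I_n})
  (w : 'S_n).

(* Up to empty rows and columns, these are the skew diagrams. *)
Definition skew S : Prop := forall i i' j j', i' < i -> j < j' ->
  (i', j') \in S -> (i, j) \in S -> (i', j) \in S /\ (i, j') \in S.

Lemma in_rothe w i j : ((i, j) \in rothe w) = (j < w i) && (i < (w^-1)%g j).
Proof. by rewrite inE. Qed.

Lemma rothe_skew w : avoids321 w -> skew (rothe w).
Proof.
move=> hw i i' j j' ii jj; rewrite !in_rothe => /andP[j'w i'w] /andP[jw iw].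
split; first by apply/andP; split; lia.
have no_descent (p : 'I_n) : i' < p < (w^-1)%g j -> j < w p <= j' -> False.
  move=> /andP[ip pj] /andP[jp pj']; apply: hw; exists i', p, ((w^-1)%g j).
  by rewrite permKV; split=> //; apply: leq_ltn_trans j'w.
apply/andP; split; rewrite ltnNge; apply/negP => le.
  by apply: (no_descent i); rewrite ?ii ?jw.
by apply: (no_descent ((w^-1)%g j')); rewrite ?permKV ?jj ?i'w ?leqnn //=;
  apply: leq_ltn_trans iw.
Qed.

Lemma card_rothe w : #|rothe w| = ninv w.
Proof.
pose g (b : 'I_n * 'I_n) := (b.1, (w^-1)%g b.2).
have g_inj : injective g by move=> [a b] [a' b'] [-> /perm_inj ->].
rewrite -(card_imset _ g_inj); apply: eq_card => -[a b]; rewrite !inE /=.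
apply/imsetP/andP => [[[i j] + [-> ->]]|[ab wab]].
  by rewrite in_rothe permKV => /andP[].
by exists (a, w b); rewrite ?in_rothe /g /= ?permK // wab.
Qed.

Lemma rothe_w0 q : (q \in rothe (w0 n)) = (q.1 + q.2 < n.-1).
Proof.
have w0V : ((w0 n)^-1)%g = w0 n.
  by apply/permP => x; apply: (@perm_inj _ (w0 n)); rewrite permKV !permE rev_ordK.
case: q => i j; rewrite in_rothe w0V !permE /=.
by have := ltn_ord i; have := ltn_ord j; lia.
Qed.

End Shapes.

(** * Moves of diagrams *)

Section DiagramMoves.
Variable n : nat.
Implicit Types (D E : diagram n) (l : label) (i j r s t c : 'I_n).

Definition remnant (keep : bool) : option label := if keep then Some ghost else None.

Definition can_move (D : diagram n) l r j r' : bool :=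
  [&& rightmost D r j, landing D r j r'
    & [forall s : 'I_n, (r' < s <= r) ==> (D (s, j) == Some l)]].

Definition moved (D : diagram n) l (keep : bool) r j r' : diagram n :=
  [ffun q => if q == (r', j) then Some l
             else if q == (r, j) then remnant keep else D q].

Lemma moveP l keep D E :
  reflect (exists r j r', can_move D l r j r' /\ E = moved D l keep r j r')
    (move l (remnant keep) D E).
Proof.
apply: (iffP existsP) => [[r /existsP[j /existsP[r' /and4P[rm la lab /eqP->]]]]|].
  by exists r, j, r'; rewrite /can_move rm la.
move=> [r [j [r' [/and3P[rm la lab] ->]]]]; exists r.
by apply/existsP; exists j; apply/existsP; exists r'; apply/and4P.
Qed.

Lemma can_moveP D l r j r' :
  reflect [/\ r' < r, D (r', j) = None, forall c, j < c -> D (r, c) = None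
             & forall s, r' < s <= r -> D (s, j) = Some l] (can_move D l r j r').
Proof.
apply: (iffP and3P) => [[/andP[rD /forallP right]]|[r'r r'D right labels]].
  move=> /and3P[r'r r'D _] /forallP labels; split.
  - by rewrite ltn_neqAle r'r andbT; apply: contraNneq r'D => /ord_inj ->.
  - by move: r'D; rewrite inE negbK => /eqP.
  - by move=> c jc; have /implyP/(_ jc) := right c; rewrite inE negbK => /eqP.
  - by move=> s rs; have /implyP/(_ rs)/eqP := labels s.
split; first apply/andP; first split.
- by rewrite inE labels // r'r leqnn.
- by apply/forallP => c; apply/implyP => /right rc; rewrite inE rc.
- apply/and3P; split; rewrite ?inE ?r'D ?(ltnW r'r) //.
  apply/forallP => s; apply/implyP => /andP[sr]; rewrite inE leqNgt.
  by apply: contra => r's; rewrite labels ?r's.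
- by apply/forallP => s; apply/implyP => /labels ->.
Qed.

Lemma val_ordS s r : s < r -> ordS s = s.+1 :> nat.
Proof. by move=> lt; rewrite /= modn_small //; apply: leq_ltn_trans lt (ltn_ord r). Qed.

(* A jump over several boxes is a single step followed by a shorter jump. *)
Lemma can_move_jump D l r j r' s : can_move D l r j r' -> s = r'.+1 :> nat -> s < r ->
  can_move (moved D l false s j r') l r j s.
Proof.
move=> /can_moveP[r'r r'D right labels] sE sr; apply/can_moveP;
  split=> // [|c jc|t /andP[st tr]].
- by rewrite ffunE !xpair_eqE -!val_eqE /= sE gtn_eqF // !eqxx.
- by rewrite ffunE !xpair_eqE -!val_eqE /= (gtn_eqF jc) !andbF right.
- have r't : r' < t by rewrite (ltn_trans _ st) // sE.
  by rewrite ffunE !xpair_eqE -!val_eqE /= (gtn_eqF st) (gtn_eqF r't) labels ?r't.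
Qed.

Lemma moved_jump D l keep r j r' s : can_move D l r j r' -> s = r'.+1 :> nat -> s < r ->
  moved (moved D l false s j r') l keep r j s = moved D l keep r j r'.
Proof.
move=> /can_moveP[r'r _ _ labels] sE sr; apply/ffunP => -[t c]; rewrite !ffunE !xpair_eqE.
case: (eqVneq c j) => [->|_]; rewrite ?andbF // !andbT.
case: (eqVneq t s) => [->|_].
  by rewrite labels ?sE ?leqnn -?sE ?(ltnW sr) // -!val_eqE /= (ltn_eqF sr) sE gtn_eqF.
by case: (eqVneq t r') => // ->; rewrite -val_eqE /= (ltn_eqF r'r).
Qed.

End DiagramMoves.

(** * Set-valued tableaux *)

Definition filling (n : nat) := {ffun 'I_n * 'I_n -> {set 'I_n}}.

Lemma filling_injective (n : nat) (aT : Type) (D : {set filling n}) (f : filling n -> aT) :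
  {in D &, forall T T', f T = f T' -> forall b, T b \subset T' b} -> {in D &, injective f}.
Proof.
move=> sub T T' TD T'D e; apply/ffunP => b; apply/eqP.
by rewrite eqEsubset (sub T T') ?(sub T' T).
Qed.

Section Tableaux.
Variables (n : nat) (S : {set 'I_n * 'I_n}).
Implicit Types (i j r s t x y c : 'I_n) (b q : 'I_n * 'I_n) (T : filling n).

Definition tableau T : bool :=
  [&& [forall b, (T b != set0) == (b \in S)],
      [forall i : 'I_n, forall j : 'I_n, forall j' : 'I_n, (j < j') ==>
         [forall r in T (i, j), forall s in T (i, j'), s <= r]],
      [forall i : 'I_n, forall i' : 'I_n, forall j : 'I_n, (i < i') ==>
         [forall r in T (i, j), forall s in T (i', j), r < s]]
    & [forall i : 'I_n, forall j : 'I_n, forall r in T (i, j), r <= i]].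

Definition tableaux : {set filling n} := [set T | tableau T].

Lemma tableauP T : reflect
  [/\ forall b, (T b != set0) = (b \in S),
      forall i j j' r s, j < j' -> r \in T (i, j) -> s \in T (i, j') -> s <= r,
      forall i i' j r s, i < i' -> r \in T (i, j) -> s \in T (i', j) -> r < s
    & forall i j r, r \in T (i, j) -> r <= i] (tableau T).
Proof.
apply: (iffP and4P) => -[hS hrow hcol hflag]; split.
- by move=> b; exact: (eqP (forallP hS b)).
- move=> i j j' r s lt rT sT.
  have /forallP/(_ i)/forallP/(_ j)/forallP/(_ j')/implyP/(_ lt) := hrow.
  by move/forall_inP/(_ r rT)/forall_inP/(_ s sT).
- move=> i i' j r s lt rT sT.
  have /forallP/(_ i)/forallP/(_ i')/forallP/(_ j)/implyP/(_ lt) := hcol.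
  by move/forall_inP/(_ r rT)/forall_inP/(_ s sT).
- move=> i j r rT.
  by have /forallP/(_ i)/forallP/(_ j)/forall_inP/(_ r rT) := hflag.
- by apply/forallP => b; rewrite hS.
- apply/forallP => i; apply/forallP => j; apply/forallP => j'; apply/implyP => lt.
  by apply/forall_inP => r rT; apply/forall_inP => s sT; apply: hrow lt rT sT.
- apply/forallP => i; apply/forallP => i'; apply/forallP => j; apply/implyP => lt.
  by apply/forall_inP => r rT; apply/forall_inP => s sT; apply: hcol lt rT sT.
- apply/forallP => i; apply/forallP => j; apply/forall_inP => r; exact: hflag.
Qed.

Section TableauTheory.
Variable T : filling n.
Hypothesis tabT : tableau T.

Lemma tableau_neq0 b : (T b != set0) = (b \in S).
Proof. by have /tableauP[] := tabT. Qed.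

Lemma tableau_row i j j' r s : j < j' -> r \in T (i, j) -> s \in T (i, j') -> s <= r.
Proof. by have /tableauP[_ h _ _] := tabT; apply: h. Qed.

Lemma tableau_col i i' j r s : i < i' -> r \in T (i, j) -> s \in T (i', j) -> r < s.
Proof. by have /tableauP[_ _ h _] := tabT; apply: h. Qed.

Lemma tableau_flag i j r : r \in T (i, j) -> r <= i.
Proof. by have /tableauP[_ _ _ h] := tabT; apply: h. Qed.

Lemma tableau_shape b r : r \in T b -> b \in S.
Proof. by move=> rT; rewrite -tableau_neq0; apply/set0Pn; exists r. Qed.

Lemma tableau_exists b : b \in S -> exists r, r \in T b.
Proof. by rewrite -tableau_neq0 => /set0Pn. Qed.

Lemma tableau_topmost b : b \in S ->
  exists2 m, m \in T b & forall s, s \in T b -> m <= s.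
Proof.
by move=> /tableau_exists[r rT]; exists [arg min_(m < r in T b) m]; case: arg_minnP.
Qed.

Lemma tableau_displaced_lt i j m : m \in T (i, j) ->
  (forall s, s \in T (i, j) -> m <= s) -> T (i, j) != [set i] -> m < i.
Proof.
move=> mT min_m; apply: contraNltn => im.
have eq_i s : s \in T (i, j) -> s = i.
  by move=> sT; apply: ord_inj; have := min_m _ sT; have := tableau_flag sT; ord_lia.
have iT : i \in T (i, j) by have := mT; rewrite {1}(eq_i _ mT).
by rewrite eqEsubset sub1set iT andbT; apply/subsetP => s /eq_i ->; rewrite inE.
Qed.

Lemma tableau_col_inj i i' j r : r \in T (i, j) -> r \in T (i', j) -> i = i'.
Proof.
move=> h h'; case: (ltngtP i i') => [lt|lt|/ord_inj //].
  by have := tableau_col lt h h'; rewrite ltnn.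
by have := tableau_col lt h' h; rewrite ltnn.
Qed.

End TableauTheory.

Definition diagram_of T : diagram n :=
  [ffun q => if [pick i | q.1 \in T (i, q.2)] is Some i
             then Some [forall s in T (i, q.2), q.1 <= s] else None].

Lemma diagram_of_box T i j r : tableau T -> r \in T (i, j) ->
  diagram_of T (r, j) = Some [forall s in T (i, j), r <= s].
Proof.
move=> tabT rT; rewrite ffunE; case: pickP => [i' /= /(tableau_col_inj tabT rT) <- //|].
by move/(_ i); rewrite /= rT.
Qed.

Lemma diagram_of_noneP T j r :
  diagram_of T (r, j) = None <-> forall i, r \notin T (i, j).
Proof.
rewrite ffunE; case: pickP => /= [i rT|rT]; split=> //.
  by move/(_ i); rewrite rT.
by move=> _ i; rewrite rT.
Qed.

Lemma eq_diagram_of_col T T' j r : (forall i, T (i, j) = T' (i, j)) ->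
  diagram_of T (r, j) = diagram_of T' (r, j).
Proof.
move=> e; rewrite !ffunE /= (@eq_pick _ _ (fun i => r \in T' (i, j))) => [|i].
  by case: pickP => // i _; rewrite e.
by rewrite e.
Qed.

Lemma diagram_of_boxP T r j :
  reflect (exists i, r \in T (i, j)) ((r, j) \in boxes (diagram_of T)).
Proof.
rewrite inE ffunE /=; apply: (iffP idP) => [|[i rT]].
  by case: pickP => // i rT _; exists i.
by case: pickP => // /(_ i); rewrite rT.
Qed.

Lemma diagram_of_labelP T r j l : tableau T -> diagram_of T (r, j) = Some l ->
  exists2 i, r \in T (i, j) & l = [forall s in T (i, j), r <= s].
Proof.
move=> tabT e; have /diagram_of_boxP[i rT] : (r, j) \in boxes (diagram_of T) by rewrite inE e.
by exists i => //; move: e; rewrite (diagram_of_box tabT rT) => -[].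
Qed.

Lemma diagram_of_black T i j r : tableau T -> r \in T (i, j) ->
  (forall s, s \in T (i, j) -> r <= s) -> diagram_of T (r, j) = Some black.
Proof.
move=> tabT rT min_r; rewrite (diagram_of_box tabT rT); congr Some.
exact/forall_inP.
Qed.

(* A ghost belongs to the nearest black box above it in its column. *)
Lemma card_black_above T i j r : tableau T -> r \in T (i, j) ->
  #|[set s : 'I_n | (s <= r) && (diagram_of T (s, j) == Some black)]|
    = #|[set x : 'I_n | (x <= i) && ((x, j) \in S)]|.
Proof.
move=> tabT rT.
pose top x := odflt r [pick m in T (x, j) | [forall s in T (x, j), m <= s]].
have topP x : (x, j) \in S ->
    top x \in T (x, j) /\ forall s, s \in T (x, j) -> top x <= s.
  move=> /(tableau_topmost tabT)[m mT /forall_inP min_m]; rewrite /top.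
  by case: pickP => [t /andP[? /forall_inP]|/(_ m)] //=; rewrite mT min_m.
have top_inj : {in [set x : 'I_n | (x <= i) && ((x, j) \in S)] &, injective top}.
  move=> x y; rewrite !inE => /andP[_ /topP[xT _]] /andP[_ /topP[yT _]] e.
  by apply: (tableau_col_inj tabT xT); rewrite e.
rewrite -(card_in_imset top_inj); congr #|pred_of_set _|; apply/setP => s.
rewrite inE; apply/andP/imsetP => [[sr /eqP/(diagram_of_labelP tabT)[x sT]]|[x]].
  move=> /esym/forall_inP min_s; have xS := tableau_shape tabT sT.
  have [topT min_top] := topP x xS; exists x; last first.
    by apply: ord_inj; have := min_s _ topT; have := min_top _ sT; ord_lia.
  rewrite inE xS andbT leqNgt; apply/negP => lt.
  by have := tableau_col tabT lt rT sT; ord_lia.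
rewrite inE => /andP[xi /topP[topT min_top]] ->; split; last first.
  by apply/eqP; apply: diagram_of_black topT min_top.
case: (ltngtP x i) xi => // [lt _|/ord_inj e _].
  by rewrite ltnW // (tableau_col tabT lt topT rT).
by apply: min_top; rewrite e.
Qed.

Lemma diagram_of_inj : {in tableaux &, injective diagram_of}.
Proof.
apply: filling_injective => T T'; rewrite !inE => tabT tabT' e [i j]; apply/subsetP => r rT.
have /diagram_of_boxP[i' rT'] : (r, j) \in boxes (diagram_of T').
  by rewrite -e; apply/diagram_of_boxP; exists i.
suff -> : i = i' by [].
have := card_black_above tabT rT; rewrite e (card_black_above tabT' rT') => same_card.
have card_lt x y : (y, j) \in S -> x < y ->
    #|[set z : 'I_n | (z <= x) && ((z, j) \in S)]|
      < #|[set z : 'I_n | (z <= y) && ((z, j) \in S)]|.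
  by move=> yS xy; apply: (@card_ord_sep_lt _ (fun z => (z, j) \in S) y x.+1 y.+1);
    rewrite ?xy /=.
case: (ltngtP i i') => [lt|lt|/ord_inj //].
  by have := card_lt _ _ (tableau_shape tabT' rT') lt; rewrite same_card ltnn.
by have := card_lt _ _ (tableau_shape tabT rT) lt; rewrite same_card ltnn.
Qed.

Definition base_tableau : filling n := [ffun b => if b \in S then [set b.1] else set0].

Lemma in_base_tableau b r : (r \in base_tableau b) = (b \in S) && (r == b.1).
Proof. by rewrite ffunE; case: ifP; rewrite !inE. Qed.

Lemma tableau_base : tableau base_tableau.
Proof.
apply/tableauP; split=> [b|i j j' r s lt|i i' j r s lt|i j r]; rewrite ?in_base_tableau.
- by rewrite ffunE; case: ifP => _; rewrite ?eqxx // -card_gt0 cards1.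
- by move=> /andP[_ /eqP->] /andP[_ /eqP->].
- by move=> /andP[_ /eqP->] /andP[_ /eqP->].
- by move=> /andP[_ /eqP->].
Qed.

Lemma diagram_of_base : diagram_of base_tableau = all_black S.
Proof.
apply/ffunP => -[r j]; rewrite [RHS]ffunE; case: ifP => rS.
  apply: (@diagram_of_black _ r _ _ tableau_base); first by rewrite in_base_tableau rS /=.
  by move=> s; rewrite in_base_tableau => /andP[_ /eqP->].
apply/diagram_of_noneP => i; rewrite in_base_tableau.
by apply/negP => /andP[iS /eqP e]; rewrite e /= iS in rS.
Qed.

(* Every move acts on tableaux by such a replacement, or by several of them. *)
Definition replace T b s s' (keep : bool) : filling n :=
  [ffun q => if q == b then s' |: (if keep then T b else T b :\ s) else T q].

Lemma replace_same T b s s' keep :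
  replace T b s s' keep b = s' |: (if keep then T b else T b :\ s).
Proof. by rewrite ffunE eqxx. Qed.

Lemma replace_other T b s s' keep q : q != b -> replace T b s s' keep q = T q.
Proof. by rewrite ffunE => /negPf->. Qed.

Lemma replaceP T b s s' keep q t : t \in replace T b s s' keep q ->
  t \in T q \/ q = b /\ t = s'.
Proof.
rewrite ffunE; case: eqP => [->|_ ?]; last by left.
by rewrite in_setU1 => /orP[/eqP->|]; [right | case: keep => [|/setD1P[]]; left].
Qed.

Lemma replace_tableau T x j s s' keep : tableau T -> (x, j) \in S -> s' <= x ->
  (forall c t, c < j -> t \in T (x, c) -> s' <= t) ->
  (forall c t, j < c -> t \in T (x, c) -> t <= s') ->
  (forall y t, y < x -> t \in T (y, j) -> t < s') ->
  (forall y t, x < y -> t \in T (y, j) -> s' < t) ->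
  tableau (replace T (x, j) s s' keep).
Proof.
move=> tabT xS flag left right above below; apply/tableauP; split.
- move=> b; rewrite -(tableau_neq0 tabT); case: (eqVneq b (x, j)) => [->|ne].
    rewrite replace_same (tableau_neq0 tabT) xS; apply/set0Pn.
    by exists s'; rewrite setU11.
  by rewrite replace_other.
- move=> i c c' t t' lt /replaceP[tT|[[? ?] ?]] /replaceP[tT'|[[? ?] ?]]; subst.
  + exact: tableau_row lt tT tT'.
  + exact: left lt tT.
  + exact: right lt tT'.
  + by rewrite ltnn in lt.
- move=> i i' c t t' lt /replaceP[tT|[[? ?] ?]] /replaceP[tT'|[[? ?] ?]]; subst.
  + exact: tableau_col lt tT tT'.
  + exact: above lt tT.
  + exact: below lt tT'.
  + by rewrite ltnn in lt.
- by move=> i c t /replaceP[/(tableau_flag tabT)|[[-> _] ->]].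
Qed.

Lemma in_replace_neq T b s s' keep q t : t != s -> t != s' ->
  (t \in replace T b s s' keep q) = (t \in T q).
Proof.
move=> ts ts'; rewrite ffunE; case: eqP => [->|//].
by case: keep; rewrite !inE (negPf ts') ?ts.
Qed.

Section ReplacedLabels.
Variables (A : {set 'I_n}) (s s' : 'I_n) (keep : bool).
Hypotheses (sA : s \in A) (s's : s' < s).
Let A' := s' |: (if keep then A else A :\ s).

Let mem_replaced u : u != s -> u \in A -> u \in A'.
Proof. by move=> us uA; rewrite !inE; case: (keep); rewrite ?inE ?us uA ?orbT. Qed.

Let replaced_mem u : u \in A' -> u = s' \/ u \in A.
Proof. by case/setU1P => [->|]; [left | case: (keep) => [|/setD1P[]]; right]. Qed.

Lemma replaced_source : (s \in A') = keep.
Proof.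
rewrite in_setU1 -val_eqE /= (gtn_eqF s's) /=.
by case: (keep); rewrite ?sA ?inE ?eqxx.
Qed.

Lemma replaced_topmost :
  [forall u in A', s' <= u] = [forall u in A, s' <= u].
Proof.
apply/forall_inP/forall_inP => h u; last by move=> /replaced_mem[->|/h].
by case: (eqVneq u s) => [-> _|us uA]; [apply: ltnW | apply/h/mem_replaced].
Qed.

Lemma eq_topmost_replaced t :
  [forall u in A, s <= u] = [forall u in A, s' <= u] -> t \in A -> t != s ->
  [forall u in A', t <= u] = [forall u in A, t <= u].
Proof.
move=> same tA ts; have s'A' : s' \in A' by rewrite setU11.
apply/forall_inP/forall_inP => h u uA.
  case: (eqVneq u s) => [->|us]; last by apply/h/mem_replaced.
  exact: leq_trans (h _ s'A') (ltnW s's).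
case/replaced_mem: (uA) => [->|/h //]; rewrite leqNgt; apply/negP => s't.
have /forall_inP min_s : [forall u in A, s <= u].
  by rewrite same; apply/forall_inP => v /h; apply: leq_trans (ltnW s't).
by have := min_s _ tA; have := h _ sA; rewrite -val_eqE /= in ts; ord_lia.
Qed.

End ReplacedLabels.

Lemma diagram_of_replace T l x j s s' keep : tableau T ->
  tableau (replace T (x, j) s s' keep) -> s \in T (x, j) -> s' < s ->
  (forall y, s' \notin T (y, j)) ->
  diagram_of T (s, j) = Some l -> l = [forall t in T (x, j), s' <= t] ->
  diagram_of (replace T (x, j) s s' keep) = moved (diagram_of T) l keep s j s'.
Proof.
move=> tabT tabT' sT lt s'T label_s label_s'.
set T' := replace _ _ _ _ _ in tabT' *.
have s'T' : s' \in T' (x, j) by rewrite replace_same setU11.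
apply/ffunP => -[t c]; rewrite [RHS]ffunE !xpair_eqE.
case: (eqVneq c j) => [->|cj]; last first.
  rewrite !andbF; apply: eq_diagram_of_col => i.
  by rewrite replace_other // xpair_eqE (negPf cj) andbF.
rewrite !andbT; case: (eqVneq t s') => [->|ts'].
  by rewrite (diagram_of_box tabT' s'T') replace_same replaced_topmost // label_s'.
case: (eqVneq t s) => [->|ts].
  have sT'x y : s \in T' (y, j) -> y = x.
    case/replaceP => [sTy|[_ e]]; first exact: tableau_col_inj sTy sT.
    by rewrite e ltnn in lt.
  have sT'E : (s \in T' (x, j)) = keep.
    by rewrite replace_same replaced_source.
  rewrite /remnant; case: ifP => kE; last first.
    by apply/diagram_of_noneP => y; apply/negP => /[dup]/sT'x ->; rewrite sT'E kE.
  rewrite (@diagram_of_box _ x) // ?sT'E //; congr Some;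
    apply/negP => /forall_inP/(_ s' s'T').
  by rewrite leqNgt lt.
case E : (diagram_of T (t, j)) => [l'|]; last first.
  apply/diagram_of_noneP => y; rewrite in_replace_neq //.
  by move/diagram_of_noneP: E; apply.
have [y tT ->] := diagram_of_labelP tabT E.
have tT' : t \in T' (y, j) by rewrite in_replace_neq.
rewrite (diagram_of_box tabT' tT'); congr Some.
case: (eqVneq y x) => [ey|yx]; last by rewrite replace_other // xpair_eqE (negPf yx).
subst y; rewrite replace_same eq_topmost_replaced //.
by move: label_s; rewrite (diagram_of_box tabT sT) label_s' => -[].
Qed.

End Tableaux.

(** * Moves of tableaux *)

Section Moves.
Variables (n : nat) (S : {set 'I_n * 'I_n}).
Hypothesis skewS : skew S.
Implicit Types (i j r s t x y c : 'I_n) (b q : 'I_n * 'I_n) (T : filling n).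

Lemma replace_up_tableau T j x s s' keep : tableau S T -> s \in T (x, j) -> s' < s ->
  (forall c t, j < c -> t \in T (x, c) -> t <= s') ->
  (forall y t, y < x -> t \in T (y, j) -> t < s') ->
  tableau S (replace T (x, j) s s' keep).
Proof.
move=> tabT sT lt right above; apply: replace_tableau => //.
- exact: tableau_shape sT.
- by apply: leq_trans (ltnW lt) (tableau_flag tabT sT).
- by move=> c t cj tT; apply: leq_trans (ltnW lt) (tableau_row tabT cj tT sT).
- by move=> y t xy tT; apply: ltn_trans lt (tableau_col tabT xy sT tT).
Qed.

Lemma ghost_move_tableau T r j r' keep : tableau S T ->
  can_move (diagram_of T) ghost r j r' ->
  exists2 T', tableau S T' & moved (diagram_of T) ghost keep r j r' = diagram_of T'.
Proof.
move=> tabT /can_moveP[r'r /diagram_of_noneP r'T _ labels].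
have label_r : diagram_of T (r, j) = Some ghost by rewrite labels ?r'r ?leqnn.
have [x rT _] := diagram_of_labelP tabT label_r.
have [m mT min_m] := tableau_topmost tabT (tableau_shape tabT rT).
have mr' : m < r'.
  rewrite ltn_neqAle; apply/andP; split; first by apply: contraNneq (r'T x) => /ord_inj <-.
  rewrite leqNgt; apply/negP => r'm; have := labels m.
  by rewrite r'm min_m // (diagram_of_black tabT mT min_m) => /(_ isT).
have tabT' : tableau S (replace T (x, j) r r' keep).
  apply: replace_up_tableau => // [c t jc tT|y t yx tT].
    by have := tableau_row tabT jc mT tT; ord_lia.
  by have := tableau_col tabT yx tT mT; ord_lia.
exists (replace T (x, j) r r' keep) => //.
rewrite (diagram_of_replace tabT tabT' rT r'r r'T label_r) //.
by apply/esym/negP => /forall_inP/(_ _ mT); rewrite leqNgt mr'.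
Qed.

(* A blocking box right of a jumped one would, by skewness, force a box in row [r]
   right of column [j]. *)
Lemma black_jumped_rightmost T r j r' : tableau S T ->
  can_move (diagram_of T) black r j r' -> forall s x c, s \in T (x, j) ->
  r' < s <= r -> j < c -> s \notin T (x, c).
Proof.
move=> tabT /can_moveP[_ _ right labels] s.
have [k] := ubnP (r - s); elim: k s => // k IH s rsk x c sT rs jc.
apply/negP => sTc; case: (ltnP s r) => [sr|rs']; last first.
  have e : s = r by apply: ord_inj; ord_lia.
  by subst s; have /diagram_of_noneP/(_ x) := right c jc; rewrite sTc.
pose s1 := ordS s; have s1E : s1 = s.+1 :> nat := val_ordS sr.
have rs1 : r' < s1 <= r by ord_lia.
have [x1 s1T /esym/forall_inP min_s1] := diagram_of_labelP tabT (labels _ rs1).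
have xx1 : x < x1.
  case: (ltngtP x x1) => // [lt|/ord_inj e].
    by have := tableau_col tabT lt s1T sT; ord_lia.
  by subst x1; have := min_s1 _ sT; ord_lia.
have [_ x1cS] := skewS xx1 jc (tableau_shape tabT sTc) (tableau_shape tabT s1T).
have [t tT] := tableau_exists tabT x1cS.
have st := tableau_col tabT xx1 sTc tT; have ts1 := tableau_row tabT jc s1T tT.
have s1_free : s1 \notin T (x1, c) by apply: (IH _ _ x1) => //; ord_lia.
have e : t = s1 by apply: ord_inj; ord_lia.
by rewrite -e tT in s1_free.
Qed.

Lemma black_step_tableau T r j r' s keep : tableau S T ->
  can_move (diagram_of T) black r j r' -> s = r'.+1 :> nat -> exists2 T', tableau S T' &
    moved (diagram_of T) black keep s j r' = diagram_of T'.
Proof.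
move=> tabT mv sE; have /can_moveP[r'r /diagram_of_noneP r'T _ labels] := mv.
have rs : r' < s <= r by ord_lia.
have r's : r' < s by rewrite sE.
have [x sT /esym/forall_inP min_s] := diagram_of_labelP tabT (labels _ rs).
have tabT' : tableau S (replace T (x, j) s r' keep).
  apply: replace_up_tableau => // [c t jc tT|y t yx tT].
    have : t != s by apply: contraTneq tT => ->;
      apply: black_jumped_rightmost mv _ _ _ sT rs jc.
    by rewrite -val_eqE /=; have := tableau_row tabT jc sT tT; ord_lia.
  have : t != r' by apply: contraTneq tT => ->.
  by rewrite -val_eqE /=; have := tableau_col tabT yx tT sT; ord_lia.
exists (replace T (x, j) s r' keep) => //.
rewrite (diagram_of_replace tabT tabT' sT r's r'T (labels _ rs)) //.
by apply/esym/forall_inP => t /min_s; apply: leq_trans (ltnW r's).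
Qed.

Lemma black_move_tableau T r j r' keep : tableau S T ->
  can_move (diagram_of T) black r j r' ->
  exists2 T', tableau S T' & moved (diagram_of T) black keep r j r' = diagram_of T'.
Proof.
have [k] := ubnP (r - r'); elim: k T r' => // k IH T r' rk tabT mv.
have /can_moveP[r'r _ _ _] := mv.
have [s sE] : exists s : 'I_n, s = r'.+1 :> nat by exists (ordS r'); apply: val_ordS r'r.
case: (ltngtP s r) => [sr||/ord_inj sr]; [|by ord_lia|]; last first.
  by subst s; apply: black_step_tableau tabT mv sE.
have [T1 tabT1 e1] := black_step_tableau false tabT mv sE.
rewrite -(moved_jump keep mv sE sr) e1; apply: IH => //; first by ord_lia.
by rewrite -e1; apply: can_move_jump mv sE sr.
Qed.

Lemma move_tableau l keep T E : tableau S T ->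
  move l (remnant keep) (diagram_of T) E ->
  exists2 T', tableau S T' & E = diagram_of T'.
Proof.
move=> tabT /moveP[r [j [r' [mv ->]]]].
by case: l mv => mv; [apply: black_move_tableau | apply: ghost_move_tableau].
Qed.

Lemma KKoh_sub_tKKoh : KKoh S \subset tKKoh S.
Proof.
apply/subsetP => E; rewrite !inE; apply: (@connect_sub _ _ _ _ (all_black S) E) => D D' h.
by apply: connect1; case/orP: h => ->; rewrite ?orbT.
Qed.

Lemma tKKoh_tableau E : E \in tKKoh S -> exists2 T, tableau S T & E = diagram_of T.
Proof.
rewrite inE => /connectP[p]; rewrite -diagram_of_base.
elim: p (base_tableau S) (tableau_base S) => [|D p IH] T tabT /=;
  first by move=> _ ->; exists T.
move=> /andP[step]; suff [T' tabT' ->] : exists2 T', tableau S T' & D = diagram_of T'.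
  exact: IH.
case/or4P: step => step.
- exact: (@move_tableau black false T).
- exact: (@move_tableau black true T).
- exact: (@move_tableau ghost false T).
- exact: (@move_tableau ghost true T).
Qed.

Definition height T : nat := \sum_b \sum_(s in T b) (n - s).

Lemma height_replace_lt T b s s' : s \in T b -> s < s' ->
  height (replace T b s s' false) < height T.
Proof.
move=> sT lt; rewrite /height (bigD1 b) //= [X in _ < X](bigD1 b) //=.
rewrite (eq_bigr (fun q => \sum_(t in T q) (n - t))) => [|q qb];
  last by rewrite replace_other.
rewrite ltn_add2r replace_same [X in _ < X](big_setD1 s) //=.
have ns : n - s' < n - s by have := ltn_ord s'; ord_lia.
case: (boolP (s' \in T b :\ s)) => s'T; last by rewrite big_setU1 //= ltn_add2r.
rewrite (setUidPr _) ?sub1set //; apply: leq_ltn_trans (leq_addl (n - s') _) _.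
by rewrite ltn_add2r.
Qed.

Section LowerOneBox.
Variables (T : filling n) (a j m m1 : 'I_n).
Hypotheses (tabT : tableau S T) (ajS : (a, j) \in S).
Hypotheses (mT : m \in T (a, j)) (min_m : forall s, s \in T (a, j) -> m <= s).
Hypotheses (m_lt_a : m < a) (m1E : m1 = m.+1 :> nat).
Hypothesis below : forall i c, a < i -> (i, c) \in S -> T (i, c) = [set i].
Hypothesis left : forall c, c < j -> (a, c) \in S -> T (a, c) = [set a].

Let T' := replace T (a, j) m m1 false.

Let below_eq i c t : a < i -> t \in T (i, c) -> t = i.
Proof.
by move=> ai /[dup]/(tableau_shape tabT)/(below ai)->; rewrite inE => /eqP.
Qed.

Let left_eq c t : c < j -> t \in T (a, c) -> t = a.
Proof.
by move=> cj /[dup]/(tableau_shape tabT)/(left cj)->; rewrite inE => /eqP.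
Qed.

Lemma lowered_tableau : tableau S T'.
Proof.
apply: replace_tableau => //
  [|c t cj /(left_eq cj)->|c t jc tT|y t ya tT|y t ay /(below_eq ay)->].
- by rewrite m1E.
- by rewrite m1E.
- by have := tableau_row tabT jc mT tT; ord_lia.
- by have := tableau_col tabT ya tT mT; ord_lia.
- by ord_lia.
Qed.

Let m1T' : m1 \in T' (a, j).
Proof. by rewrite replace_same setU11. Qed.

Let m_free y : m \notin T' (y, j).
Proof.
case: (eqVneq y a) => [->|ya].
  rewrite replace_same !inE eqxx /= orbF -val_eqE /= m1E; ord_lia.
rewrite replace_other ?xpair_eqE ?(negPf ya) //.
by apply: contraNN ya => /(tableau_col_inj tabT mT)->.
Qed.

Let min_m1 s : s \in T' (a, j) -> m1 <= s.
Proof.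
rewrite replace_same !inE => /orP[/eqP->|/andP[sm sT]] //.
by have := min_m sT; rewrite -val_eqE /= in sm; ord_lia.
Qed.

Let right_free x c : j < c -> m1 \notin T' (x, c).
Proof.
move=> jc; rewrite replace_other;
  last by rewrite xpair_eqE -[c == j]val_eqE /= (gtn_eqF jc) andbF.
apply/negP => m1T; case: (ltngtP x a) => [xa|ax|/ord_inj e].
- have [xjS _] := skewS xa jc (tableau_shape tabT m1T) ajS.
  have [t tT] := tableau_exists tabT xjS.
  by have := tableau_row tabT jc tT m1T; have := tableau_col tabT xa tT mT; ord_lia.
- by have := m1E; rewrite (below_eq ax m1T); ord_lia.
- by subst x; have := tableau_row tabT jc mT m1T; ord_lia.
Qed.

Lemma raise_lowered : replace T' (a, j) m1 m (m1 \in T (a, j)) = T.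
Proof.
apply/ffunP => b; case: (eqVneq b (a, j)) => [->|ne]; last by rewrite !replace_other.
rewrite !replace_same; apply/setP => t; rewrite !inE.
case: (eqVneq t m) => [->|tm] /=; first by rewrite mT.
by case: ifP => m1T; rewrite !inE (negPf tm) /=; case: (eqVneq t m1) => // ->; rewrite m1T.
Qed.

Lemma lowered_move :
  kohnert (diagram_of T') (diagram_of T) || k_kohnert (diagram_of T') (diagram_of T).
Proof.
have label_m1 : diagram_of T' (m1, j) = Some black :=
  diagram_of_black lowered_tableau m1T' min_m1.
have lt : m < m1 by rewrite m1E.
have tabT2 : tableau S (replace T' (a, j) m1 m (m1 \in T (a, j))) by rewrite raise_lowered.
have moved_m1 : diagram_of T = moved (diagram_of T') black (m1 \in T (a, j)) m1 j m.
  rewrite -{1}raise_lowered (diagram_of_replace lowered_tableau tabT2 m1T' lt m_free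
    label_m1) //.
  by apply/esym/forall_inP => t /min_m1; apply: leq_trans (ltnW lt).
have movable : can_move (diagram_of T') black m1 j m.
  apply/can_moveP; split=> // [|c jc|s /andP[ms sm1]].
  - exact/diagram_of_noneP.
  - by apply/diagram_of_noneP => x; apply: right_free.
  - by have -> : s = m1 by apply: ord_inj; ord_lia.
have : move black (remnant (m1 \in T (a, j))) (diagram_of T') (diagram_of T).
  by apply/moveP; exists m1, j, m.
by rewrite /kohnert /k_kohnert /remnant; case: ifP => _ ->; rewrite ?orbT.
Qed.

End LowerOneBox.

(* In the lowest row that differs from the shape, the leftmost displaced box can be
   moved back down by one row. *)
Lemma exists_lowered T : tableau S T -> T != base_tableau S ->
  exists T', [/\ tableau S T', height T' < height T
    & kohnert (diagram_of T') (diagram_of T) || k_kohnert (diagram_of T') (diagram_of T)].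
Proof.
move=> tabT neq; pose displaced b := (b \in S) && (T b != [set b.1]).
have /existsP[[i0 j0] displaced0] : [exists b, displaced b].
  apply: contraNT neq; rewrite negb_exists => /forallP h; apply/eqP/ffunP => b; rewrite ffunE.
  have := h b; rewrite /displaced; case: ifP => [_ /negbNE/eqP //|bS _].
  by apply/eqP; apply: contraFT bS => ?; rewrite -(tableau_neq0 tabT).
pose displaced_row i := [exists j, displaced (i, j)].
have row0 : displaced_row i0 by apply/existsP; exists j0.
have [a /existsP[j1 displaced1] max_a] := arg_maxnP (@nat_of_ord n) row0.
have [j /andP[ajS ne] min_j] :=
  @arg_minnP _ j1 [pred j | displaced (a, j)] (@nat_of_ord n) displaced1.
have [m mT min_m] := tableau_topmost tabT ajS.
have below i c : a < i -> (i, c) \in S -> T (i, c) = [set i].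
  move=> ai icS; apply/eqP; apply: contraLR ai => h; rewrite -leqNgt.
  by apply: max_a; apply/existsP; exists c; apply/andP.
have left c : c < j -> (a, c) \in S -> T (a, c) = [set a].
  move=> cj acS; apply/eqP; apply: contraLR cj => h; rewrite -leqNgt.
  by apply: min_j; apply/andP.
have m_lt_a : m < a := tableau_displaced_lt tabT mT min_m ne.
pose m1 := ordS m; have m1E : m1 = m.+1 :> nat := val_ordS m_lt_a.
exists (replace T (a, j) m m1 false); split.
- exact: lowered_tableau.
- by apply: height_replace_lt => //; rewrite m1E.
- exact: lowered_move.
Qed.

Lemma tableau_KKoh T : tableau S T -> diagram_of T \in KKoh S.
Proof.
have [k] := ubnP (height T); elim: k T => // k IH T hk tabT.
case: (eqVneq T (base_tableau S)) => [->|neq]; first by rewrite diagram_of_base inE connect0.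
have [T' [tabT' lt step]] := exists_lowered tabT neq.
have : diagram_of T' \in KKoh S by apply: IH => //; ord_lia.
by rewrite !inE => /connect_trans; apply; apply: connect1.
Qed.

Lemma KKoh_tableaux : KKoh S = [set diagram_of T | T in tableaux S].
Proof.
apply/setP => E; apply/idP/imsetP => [|[T]]; last by rewrite inE => /tableau_KKoh ? ->.
by move=> /(subsetP KKoh_sub_tKKoh)/tKKoh_tableau[T ? ->]; exists T; rewrite ?inE.
Qed.

Lemma tKKoh_skew : tKKoh S = KKoh S.
Proof.
apply/eqP; rewrite eqEsubset KKoh_sub_tKKoh andbT.
by apply/subsetP => E /tKKoh_tableau[T ? ->]; apply: tableau_KKoh.
Qed.

End Moves.

(** * Crossings of 0-Hecke words *)

Section Inversions.
Variable m : nat.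
Implicit Types (u : 'S_m) (l : 'I_m.-1) (x y v p q : 'I_m) (b c : 'I_m * 'I_m)
  (s : seq 'I_m.-1).

Lemma hecke_mulE u l :
  hecke_mul u l = if u (sleft l) < u (sright l) then rmul_simple u l else u.
Proof.
rewrite /hecke_mul !coxlenE; case: (asc_or_desc u l) => h.
  by rewrite (ninv_asc h) ltnSn h.
by rewrite (ninv_desc h) ltnNge leqnSn /= ltnNge (ltnW h).
Qed.

Lemma rmul_simpleV u l x : ((rmul_simple u l)^-1 x = simple l (u^-1 x))%g.
Proof. by rewrite /rmul_simple invMg permM /simple tpermV. Qed.

Lemma simple_ltn l p q : (simple l p < simple l q) =
  ((p, q) != (sleft l, sright l)) && ((p < q) || ((p, q) == (sright l, sleft l))).
Proof.
have simpleE z : simple l z = (if z == l :> nat then l.+1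
    else if z == l.+1 :> nat then l : nat else z) :> nat.
  rewrite /simple; case: tpermP => [->|->|/eqP + /eqP]; rewrite -?val_eqE /= ?eqxx //.
    by rewrite gtn_eqF.
  by move=> /negPf-> /negPf->.
by rewrite !simpleE !xpair_eqE -!val_eqE /=; do !case: eqP => ? /=; lia.
Qed.

(* [y] and [v] are values of [u], not positions. *)
Definition inverted u y v : bool := (v < y) && ((u^-1)%g y < (u^-1)%g v).

Lemma inverted1 y v : inverted 1%g y v = false.
Proof. by rewrite /inverted invg1 !perm1; lia. Qed.

Lemma inverted_count u v :
  (u^-1)%g v + #|[set x | inverted u v x]| = v + #|[set y | inverted u y v]|.
Proof.
pose A := [set x : 'I_m | (u^-1)%g x < (u^-1)%g v]; pose B := [set x : 'I_m | x < v].
have cardA : #|A| = (u^-1)%g v.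
  rewrite -[RHS](card_ord_lt (ltnW (ltn_ord _)))
    -[RHS](card_preimset _ (@perm_inj _ (u^-1)%g)).
  by apply: eq_card => x; rewrite !inE.
have cardB : #|B| = v := card_ord_lt (ltnW (ltn_ord v)).
have -> : [set x | inverted u v x] = B :\: A.
  apply/setP => x; rewrite !inE /inverted; case: (ltnP x v) => xv; rewrite ?andbF ?andbT //=.
  rewrite -leqNgt [RHS]leq_eqVlt; case: eqP => // /ord_inj/perm_inj e.
  by rewrite e ltnn in xv.
have -> : [set y | inverted u y v] = A :\: B.
  apply/setP => x; rewrite !inE /inverted -leqNgt [v <= x]leq_eqVlt.
  by case: eqP => // /ord_inj <-; rewrite !ltnn.
by rewrite -cardA -cardB -(cardsID A B) -(cardsID B A) setIC; lia.
Qed.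

Lemma inverted_inj u u' : inverted u =2 inverted u' -> u = u'.
Proof.
move=> e; apply: invg_inj; apply/permP => v; apply: ord_inj.
apply: (@addIn #|[set x | inverted u v x]|); rewrite inverted_count.
have -> : [set x | inverted u v x] = [set x | inverted u' v x]
  by apply/setP => x; rewrite !inE e.
have -> : [set x | inverted u x v] = [set x | inverted u' x v]
  by apply/setP => x; rewrite !inE e.
by rewrite -inverted_count.
Qed.

Lemma not_inverted_fix u v : (forall x, ~~ inverted u v x) -> (forall x, ~~ inverted u x v) ->
  u v = v.
Proof.
move=> no_right no_left; apply: (@perm_inj _ (u^-1)%g); rewrite permK; apply: ord_inj.
have := inverted_count u v.
have -> : [set x | inverted u v x] = set0
  by apply/setP => x; rewrite !inE (negPf (no_right x)).
have -> : [set x | inverted u x v] = set0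
  by apply/setP => x; rewrite !inE (negPf (no_left x)).
by rewrite cards0 !addn0 => ->.
Qed.

Definition crossing u l : 'I_m * 'I_m :=
  if u (sleft l) < u (sright l) then (u (sright l), u (sleft l))
  else (u (sleft l), u (sright l)).

Lemma hecke_mul_crossing u l : hecke_mul u l (sleft l) = (crossing u l).1 /\
  hecke_mul u l (sright l) = (crossing u l).2.
Proof.
rewrite hecke_mulE /crossing; case: ifP => _ //=.
by rewrite !rmul_simpleE /simple tpermL tpermR.
Qed.

Lemma inverted_hecke_mul u l y v :
  inverted (hecke_mul u l) y v = inverted u y v || ((y, v) == crossing u l).
Proof.
rewrite /inverted hecke_mulE /crossing.
rewrite -[y in LHS](permKV u) -[v in LHS](permKV u) -[y in RHS](permKV u)
  -[v in RHS](permKV u).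
move: (u^-1 y)%g (u^-1 v)%g => p q.
case: (asc_or_desc u l) => h; last first.
  rewrite [u (sleft l) < _]ltnNge (ltnW h) /= !permK xpair_eqE !(inj_eq perm_inj).
  by case: eqP => [->|_]; rewrite ?orbF //=; case: eqP => [->|_]; rewrite ?orbF //= h; lia.
rewrite h !rmul_simpleV !permK simple_ltn.
have -> : ((u p, u q) == (u (sright l), u (sleft l))) = ((p, q) == (sright l, sleft l)).
  by rewrite !xpair_eqE !(inj_eq perm_inj).
case: eqP => [[-> ->]|_] /=;
  first by rewrite ltnNge (ltnW h) xpair_eqE (negPf (sleft_neq_sright l)).
by case: eqP => [[-> ->]|_]; rewrite ?orbF // h orbT.
Qed.

Lemma inverted_crossing u l :
  inverted (hecke_mul u l) (crossing u l).1 (crossing u l).2.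
Proof. by rewrite inverted_hecke_mul -surjective_pairing eqxx orbT. Qed.

Lemma rmul_simple_neq u l : rmul_simple u l != u.
Proof.
apply/eqP => /permP/(_ (sleft l)); rewrite rmul_simpleE /simple tpermL => /perm_inj/eqP.
by rewrite eq_sym (negPf (sleft_neq_sright l)).
Qed.

Lemma hecke_mul_descent u l : hecke_mul u l (sright l) < hecke_mul u l (sleft l).
Proof. by have [-> ->] := hecke_mul_crossing u l; have /andP[] := inverted_crossing u l. Qed.

Lemma hecke_mul_eq_ascent u (V : 'S_m) l : V (sleft l) < V (sright l) ->
  (hecke_mul u l == V) = false.
Proof.
by move=> asc; apply: contraTF asc => /eqP <-; rewrite -leqNgt ltnW ?hecke_mul_descent.
Qed.

Lemma hecke_mul_eq_descent u (V : 'S_m) l : V (sleft l) < V (sright l) ->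
  (hecke_mul u l == rmul_simple V l) = (u == V) || (u == rmul_simple V l).
Proof.
move=> asc; rewrite hecke_mulE; case: ifP => asc_u.
  have /negPf -> : u != rmul_simple V l.
    apply: contraTneq asc_u => ->.
    by rewrite !rmul_simpleE /simple tpermL tpermR -leqNgt ltnW.
  rewrite orbF; apply/eqP/eqP => [e|-> //].
  by rewrite -(rmul_simpleK u l) e rmul_simpleK.
by have /negPf -> : u != V by apply: contraFneq asc_u => ->.
Qed.

Fixpoint crossings u s : seq ('I_m * 'I_m) :=
  if s is l :: s' then crossing u l :: crossings (hecke_mul u l) s' else [::].

Lemma size_crossings u s : size (crossings u s) = size s.
Proof. by elim: s u => //= l s IH u; rewrite IH. Qed.

Lemma inverted_foldl u s y v :
  inverted (foldl (@hecke_mul m) u s) y v = inverted u y v || ((y, v) \in crossings u s).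
Proof. by elim: s u => /= [|l s IH] u; rewrite ?orbF // IH inverted_hecke_mul inE orbA. Qed.

Lemma inverted_foldl1 s b :
  inverted (foldl (@hecke_mul m) 1%g s) b.1 b.2 = (b \in crossings 1 s).
Proof. by rewrite inverted_foldl inverted1 -surjective_pairing. Qed.

Lemma foldl_hecke_mul_eq1 s : foldl (@hecke_mul m) 1%g s = 1%g -> s = [::].
Proof.
case: s => // l s e; have := inverted_foldl1 (l :: s) (crossing 1 l).
by rewrite e inverted1 /= mem_head.
Qed.

End Inversions.

Section FullyCommutative.
Variables (m : nat) (W : 'S_m).
Hypothesis avoidW : avoids321 W.
Implicit Types (u : 'S_m) (l : 'I_m.-1) (x y v : 'I_m) (b c : 'I_m * 'I_m)
  (s : seq 'I_m.-1) (t : seq ('I_m * 'I_m)).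

Definition weak_le u : Prop := forall y v, inverted u y v -> inverted W y v.

Lemma weak_leW : weak_le W. Proof. by []. Qed.

Lemma weak_le_foldl u s : foldl (@hecke_mul m) u s = W -> weak_le u.
Proof. by move=> e y v h; rewrite -e inverted_foldl h. Qed.

Lemma no_inverted_chain y x v : inverted W y x -> ~~ inverted W x v.
Proof.
move=> /andP[xy pos_yx]; apply/negP => /andP[vx pos_xv]; apply: avoidW.
by exists ((W^-1)%g y), ((W^-1)%g x), ((W^-1)%g v); rewrite !permKV.
Qed.

(* The only letter at which the values of [b] can be compared in a word for [W]. *)
Definition crossing_letter b : nat :=
  b.2 + #|[set x : 'I_m | (x < b.1) && inverted W x b.2]|.

(* The values of [b] may be compared next (or again): [b.2] has been exchanged with
   all its partners below [b.1], and [b.1] with all its partners above [b.2]. *)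
Definition settled u b : Prop :=
  (forall x, x != b.1 -> inverted u x b.2 = (x < b.1) && inverted W x b.2) /\
  (forall x, x != b.2 -> inverted u b.1 x = (b.2 < x) && inverted W b.1 x).

Lemma weak_le_above0 u y v : weak_le u -> inverted W y v ->
  [set x | inverted u x y] = set0.
Proof.
move=> uW yv; apply/setP => x; rewrite !inE; apply/negP => /uW/(no_inverted_chain v).
by rewrite yv.
Qed.

Lemma weak_le_below0 u y v : weak_le u -> inverted W y v ->
  [set x | inverted u v x] = set0.
Proof.
move=> uW yv; apply/setP => x; rewrite !inE; apply/negP => /uW.
exact/negP/no_inverted_chain/yv.
Qed.

(* Every value between those of an inversion is inverted with exactly one of them. *)
Lemma crossing_letter_between y v : inverted W y v ->
  crossing_letter (y, v) + #|[set x : 'I_m | (v < x) && inverted W y x]| + 1 = y.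
Proof.
move=> yv; have /andP[vy pyv] := yv; rewrite /crossing_letter /=.
set A := [set x | _]; set B := [set x | _].
have cardAB : #|A :|: B| = y - v.+1.
  rewrite -card_ord_between; apply: eq_card => x; rewrite !inE /inverted.
  case: (ltnP v x) => vx; rewrite ?andbF //=; case: (ltnP x y) => xy //=.
  case: (ltngtP ((W^-1)%g x) ((W^-1)%g y)) => [h|_|/ord_inj/perm_inj e]; rewrite ?orbT //.
    by rewrite (ltn_trans h pyv).
  by rewrite e ltnn in xy.
have disj : A :&: B = set0.
  apply/setP => x; rewrite !inE; apply/negP => /andP[/andP[_ xv] /andP[_ yx]].
  by have := no_inverted_chain v yx; rewrite xv.
have := cardsUI A B; rewrite disj cardAB cards0 addn0 -(addnA v) => <-; ord_lia.
Qed.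

Lemma crossing_letter_row y v : inverted W y v ->
  crossing_letter (y, v) = (W^-1)%g y + #|[set x : 'I_m | (x < v) && inverted W y x]|.
Proof.
move=> yv; have := inverted_count W y; rewrite (weak_le_above0 weak_leW yv) cards0.
pose A := [set x : 'I_m | (x < v) && inverted W y x].
pose B := [set x : 'I_m | (v < x) && inverted W y x].
have -> : [set x | inverted W y x] = v |: (A :|: B).
  apply/setP => x; rewrite !inE; case: (eqVneq x v) => [->|ne] //=.
  by case: (ltngtP x v) ne => [||/ord_inj ->]; rewrite ?orbF ?eqxx.
have disj : A :&: B = set0 by apply/setP => x; rewrite !inE; case: ltngtP; rewrite ?andbF.
have := cardsUI A B; rewrite disj cards0 addn0 cardsU1 !inE !ltnn /= => -> posy.
apply: (@addIn (#|B| + 1)); rewrite addnA (crossing_letter_between yv).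
by rewrite -[LHS]addn0 -posy add1n addn1 !addnS addnA.
Qed.

Lemma settled_pos_small u b : weak_le u -> inverted W b.1 b.2 -> settled u b ->
  (u^-1)%g b.2 = crossing_letter b + inverted u b.1 b.2 :> nat.
Proof.
move=> uW bW [above _]; have := inverted_count u b.2.
rewrite (weak_le_below0 uW bW) cards0 addn0 (cardsD1 b.1) inE => ->.
rewrite addnCA addnC; congr (_ + #|pred_of_set _| + _); apply/setP => x; rewrite !inE.
by case: eqVneq => [->|/above->]; rewrite ?ltnn.
Qed.

Lemma settled_pos_large u b : weak_le u -> inverted W b.1 b.2 -> settled u b ->
  (u^-1)%g b.1 + inverted u b.1 b.2 = crossing_letter b + 1.
Proof.
move=> uW bW [_ below]; have := inverted_count u b.1.
rewrite (weak_le_above0 uW bW) cards0 addn0 (cardsD1 b.2) inE addnA.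
have -> : [set x | inverted u b.1 x] :\ b.2 = [set x : 'I_m | (b.2 < x) && inverted W b.1 x].
  by apply/setP => x; rewrite !inE; case: eqVneq => [->|/below->]; rewrite ?ltnn.
by rewrite -[in RHS](crossing_letter_between bW) -surjective_pairing; lia.
Qed.

(* In a word for [W], a value meets its smaller partners from right to left and its
   larger partners from left to right. *)
Definition crossing_order b c : bool :=
  ~~ ((b.1 == c.1) && (b.2 < c.2)) && ~~ ((b.2 == c.2) && (c.1 < b.1)).

Lemma settled_crossing_order u b c : settled u c -> inverted u b.1 b.2 -> crossing_order b c.
Proof.
case: b c => [y v] [y' v'] [above below] /= yv; rewrite /crossing_order /=.
apply/andP; split; apply/negP => /andP[/eqP e lt]; move: yv; rewrite e.
  by rewrite below /=; [case: ltngtP lt | apply: contraTneq lt => ->; rewrite ltnn].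
by rewrite above /=; [case: ltngtP lt | apply: contraTneq lt => ->; rewrite ltnn].
Qed.

Lemma settled_crossing u l b : weak_le u -> inverted W b.1 b.2 -> settled u b ->
  crossing_letter b = l -> crossing u l = b.
Proof.
move=> uW bW settled_b letter_b; have /andP[lt _] := bW.
have := settled_pos_small uW bW settled_b; have := settled_pos_large uW bW settled_b.
rewrite letter_b /crossing; case: (inverted u b.1 b.2) => large small.
  have -> : sleft l = (u^-1)%g b.1 by apply: ord_inj => /=; lia.
  have -> : sright l = (u^-1)%g b.2 by apply: ord_inj => /=; lia.
  by rewrite !permKV ltnNge (ltnW lt) -surjective_pairing.
have -> : sleft l = (u^-1)%g b.2 by apply: ord_inj => /=; lia.
have -> : sright l = (u^-1)%g b.1 by apply: ord_inj => /=; lia.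
by rewrite !permKV lt -surjective_pairing.
Qed.

Lemma crossing_settled u l :
  weak_le (hecke_mul u l) -> settled (hecke_mul u l) (crossing u l).
Proof.
move=> uW; have := inverted_crossing u l; have [] := hecke_mul_crossing u l.
move: (hecke_mul u l) uW (crossing u l) => {}u uW [y v] /= yE vE yv.
have posy : (u^-1)%g y = l :> nat by rewrite -yE permK.
have posv : (u^-1)%g v = l.+1 :> nat by rewrite -vE permK.
have no_chain x1 x2 x3 : inverted u x1 x2 -> inverted W x2 x3 -> False.
  by move/uW/(no_inverted_chain x3)/negP.
have pos_neq x z : x != z -> (u^-1)%g x != (u^-1)%g z :> nat.
  by apply: contraNneq => /ord_inj/perm_inj ->.
have W_yv := uW _ _ yv; have /andP[vy _] := yv.
split=> x /= ne; have := pos_neq _ _ ne; rewrite ?posy ?posv => pos_ne;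
  apply/idP/andP => [/[dup]/uW W_x /andP[lt pos_lt]|[lt W_x]].
- split=> //; rewrite ltnNge; apply/negP => yx; apply: (no_chain x y v) => //.
  by rewrite /inverted posy; move: ne; rewrite -val_eqE /=; ord_lia.
- have /andP[vx _] := W_x; rewrite /inverted vx /= ltnNge; apply/negP => pos_vx.
  by apply: (no_chain y x v) => //; rewrite /inverted posy; ord_lia.
- split=> //; rewrite ltnNge; apply/negP => xv; apply: (no_chain _ _ x yv); apply: uW.
  by rewrite /inverted posv; move: ne; rewrite -val_eqE /=; ord_lia.
- have /andP[xy _] := W_x; rewrite /inverted xy /= ltnNge; apply/negP => pos_xy.
  have u_xv : inverted u x v by rewrite /inverted posv; ord_lia.
  by have := no_inverted_chain v W_x; rewrite uW.
Qed.

Lemma crossing_letter_crossing u l :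
  weak_le (hecke_mul u l) -> crossing_letter (crossing u l) = l.
Proof.
move=> uW.
have := settled_pos_small uW (uW _ _ (inverted_crossing u l)) (crossing_settled uW).
by rewrite inverted_crossing addn1; have [_ <-] := hecke_mul_crossing u l;
  rewrite permK => -[].
Qed.

Lemma crossings_order b u s : inverted u b.1 b.2 -> foldl (@hecke_mul m) u s = W ->
  all (crossing_order b) (crossings u s).
Proof.
elim: s u => //= l s IH u bu e.
have bu' : inverted (hecke_mul u l) b.1 b.2 by rewrite inverted_hecke_mul bu.
by rewrite (IH _ bu' e) (settled_crossing_order (crossing_settled (weak_le_foldl e)) bu').
Qed.

Lemma pairwise_crossings u s : foldl (@hecke_mul m) u s = W ->
  pairwise crossing_order (crossings u s).
Proof.
elim: s u => //= l s IH u e; rewrite (IH _ e) andbT.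
by apply: crossings_order (inverted_crossing u l) e.
Qed.

Lemma letters_crossings u s : foldl (@hecke_mul m) u s = W ->
  map crossing_letter (crossings u s) = map val s.
Proof.
by elim: s u => //= l s IH u e; rewrite (IH _ e) (crossing_letter_crossing (weak_le_foldl e)).
Qed.

Lemma prefix_settled u t b t' :
  (forall c, (c \in t ++ b :: t') = inverted W c.1 c.2) ->
  pairwise crossing_order (t ++ b :: t') ->
  (forall c, inverted u c.1 c.2 = (c \in t)) -> settled u b.
Proof.
move=> all_W; rewrite pairwise_cat pairwise_cons =>
  /and3P[/allrelP before _ /andP[/allP after _]] uE.
have notin c : c != b -> c \notin t' -> inverted W c.1 c.2 -> c \in t.
  by move=> /negPf cb /negPf ct'; rewrite -all_W mem_cat inE cb ct' !orbF.
have sub c : c \in t -> inverted W c.1 c.2 by rewrite -all_W mem_cat => ->.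
case: b before after notin {all_W} => y v before after notin; split=> x /= ne.
  rewrite (uE (x, v)); apply/idP/andP => [xt|[lt W_xv]].
    have := before _ (y, v) xt (mem_head _ _); rewrite /crossing_order /= eqxx /= => /andP[_].
    by rewrite -leqNgt => xy; split; [rewrite ltn_neqAle ne | apply: sub xt].
  apply: notin => //; first by rewrite xpair_eqE (negPf ne).
  by apply/negP => /after; rewrite /crossing_order /= eqxx lt andbF.
rewrite (uE (y, x)); apply/idP/andP => [xt|[lt W_yx]].
  have := before _ (y, v) xt (mem_head _ _); rewrite /crossing_order /= eqxx /= => /andP[+ _].
  by rewrite -leqNgt => vx; split; [rewrite ltn_neqAle eq_sym ne | apply: sub xt].
apply: notin => //; first by rewrite xpair_eqE (negPf ne) andbF.
by apply/negP => /after; rewrite /crossing_order /= eqxx lt.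
Qed.

Lemma crossings_sorted t s : (forall b, (b \in t) = inverted W b.1 b.2) ->
  pairwise crossing_order t -> map val s = map crossing_letter t -> crossings 1 s = t.
Proof.
move=> all_W sorted_t.
suff prefix t1 t2 u : t = t1 ++ t2 -> (forall c, inverted u c.1 c.2 = (c \in t1)) ->
    forall s, map val s = map crossing_letter t2 -> crossings u s = t2.
  by apply: (prefix [::]) => // c; rewrite inverted1.
elim: t2 t1 u => [|b t2 IH] t1 u et uE [|l {}s] //= [letter_l letters].
have bW : inverted W b.1 b.2 by rewrite -all_W et mem_cat mem_head orbT.
have uW : weak_le u by move=> y v; rewrite (uE (y, v)) -(all_W (y, v)) et mem_cat => ->.
have settled_b : settled u b by apply: (@prefix_settled _ t1 _ t2); rewrite -?et.
rewrite (settled_crossing uW bW settled_b (esym letter_l)); congr cons.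
apply: (IH (rcons t1 b)) letters; first by rewrite cat_rcons.
move=> c; rewrite inverted_hecke_mul uE -surjective_pairing mem_rcons inE orbC.
by rewrite (settled_crossing uW bW settled_b (esym letter_l)).
Qed.

Lemma sorted_word t s : (forall b, (b \in t) = inverted W b.1 b.2) ->
  pairwise crossing_order t -> map val s = map crossing_letter t ->
  foldl (@hecke_mul m) 1%g s = W.
Proof.
move=> all_W sorted_t letters; apply: inverted_inj => y v.
by rewrite inverted_foldl inverted1 (crossings_sorted all_W) // all_W.
Qed.

Lemma crossing_letter_lt_col y y' v : inverted W y v -> y < y' ->
  crossing_letter (y, v) < crossing_letter (y', v).
Proof. by move=> yv lt; rewrite ltn_add2l (@card_ord_sep_lt _ _ y) // leqnn. Qed.

Lemma crossing_letter_lt_SE y y' v v' : inverted W y v -> inverted W y' v' ->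
  (W^-1)%g y < (W^-1)%g y' -> v < v' -> crossing_letter (y, v) < crossing_letter (y', v').
Proof.
move=> yv yv' py vv; have /andP[vy _] := yv; have /andP[vy' _] := yv'.
rewrite !crossing_letter_row //; set A := [set x | _]; set A' := [set x | _].
pose C := [set x : 'I_m | (W^-1)%g y < (W^-1)%g x < (W^-1)%g y'].
have sub : A \subset A' :|: C.
  apply/subsetP => x; rewrite !inE /inverted => /andP[xv /andP[xy pyx]].
  rewrite (ltn_trans xv vv) (ltn_trans xv (ltn_trans vv vy')) pyx /=.
  case: ltngtP => // /ord_inj/perm_inj e.
  by move: (ltn_trans (ltn_trans xv vv) vy'); rewrite e ltnn.
have cardC : #|C| = (W^-1)%g y' - ((W^-1)%g y).+1.
  rewrite -card_ord_between -[RHS](card_preimset _ (@perm_inj _ (W^-1)%g)).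
  by apply: eq_card => x; rewrite !inE.
apply: leq_ltn_trans (leq_add (leqnn _) (leq_trans
  (subset_leq_card sub) (leq_card_setU A' C))) _.
by rewrite cardC; lia.
Qed.

End FullyCommutative.

(** * Pipe dreams and tableaux *)

Section Extend.
Variable n : nat.
Implicit Types (u w : 'S_n) (l : 'I_n.-1) (i j : 'I_n) (b : 'I_n * 'I_n).

Lemma extendL w i : extend w (lshift n i) = lshift n (w i).
Proof. by rewrite permE /extend_fun -[lshift n i]/(unsplit (inl i)) unsplitK. Qed.

Lemma extendR w i : extend w (rshift n i) = rshift n i.
Proof. by rewrite permE /extend_fun -[rshift n i]/(unsplit (inr i)) unsplitK. Qed.

Lemma extendVL w j : ((extend w)^-1 (lshift n j) = lshift n (w^-1 j))%g.
Proof. by apply: (@perm_inj _ (extend w)); rewrite permKV extendL permKV. Qed.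

Lemma extendVR w j : ((extend w)^-1 (rshift n j) = rshift n j)%g.
Proof. by apply: (@perm_inj _ (extend w)); rewrite permKV extendR. Qed.

Lemma extendM u w : extend (u * w)%g = (extend u * extend w)%g.
Proof.
apply/permP => x; rewrite permM; case: (split_ordP x) => y ->.
  by rewrite !extendL permM.
by rewrite !extendR.
Qed.

Lemma extend1 : extend (1%g : 'S_n) = 1%g.
Proof.
apply/permP => x; rewrite perm1; case: (split_ordP x) => y ->; last by rewrite extendR.
by rewrite extendL perm1.
Qed.

Fact wide_letter_subproof (l : 'I_n.-1) : l < (n + n).-1.
Proof. by have := ltn_ord l; lia. Qed.

Definition wide_letter l : 'I_(n + n).-1 := Ordinal (wide_letter_subproof l).

Lemma sleft_wide l : sleft (wide_letter l) = lshift n (sleft l).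
Proof. exact: val_inj. Qed.

Lemma sright_wide l : sright (wide_letter l) = lshift n (sright l).
Proof. exact: val_inj. Qed.

Lemma extend_simple l : extend (simple l) = simple (wide_letter l).
Proof.
apply/permP => x; rewrite /simple sleft_wide sright_wide; case: (split_ordP x) => y ->.
  by rewrite extendL (inj_tperm _ _ _ (@lshift_inj n n)).
by rewrite extendR tpermD // eq_lrshift.
Qed.

Lemma extend_rmul_simple w l :
  extend (rmul_simple w l) = rmul_simple (extend w) (wide_letter l).
Proof. by rewrite /rmul_simple extendM extend_simple. Qed.

Lemma avoids321_extend w : avoids321 w -> avoids321 (extend w).
Proof.
move=> hw [a [b [c []]]].
case: (split_ordP a) => a' ->; case: (split_ordP b) => b' ->; case: (split_ordP c) => c' ->;
  rewrite ?extendL ?extendR /= => ab bc wba wcb; first by apply: hw; exists a', b', c'.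
all: by have := ltn_ord b'; have := ltn_ord c'; have := ltn_ord (w a');
        have := ltn_ord (w b'); ord_lia.
Qed.

Definition value_pair w b : 'I_(n + n) * 'I_(n + n) := (lshift n (w b.1), lshift n b.2).

Lemma value_pair_inj w : injective (value_pair w).
Proof. by move=> [i j] [i' j'] [/ord_inj/perm_inj-> /ord_inj->]. Qed.

Lemma inverted_value_pair w b :
  inverted (extend w) (value_pair w b).1 (value_pair w b).2 = (b \in rothe w).
Proof. by case: b => i j; rewrite in_rothe /inverted !extendVL permK. Qed.

Lemma inverted_extendP w y v :
  reflect (exists2 b, b \in rothe w & (y, v) = value_pair w b) (inverted (extend w) y v).
Proof.
apply: (iffP idP) => [|[b bw [-> ->]]]; last by rewrite -inverted_value_pair in bw.
case: (split_ordP y) => y' ->; case: (split_ordP v) => v' ->.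
- rewrite -[y'](permKV w) => yv; exists ((w^-1)%g y', v') => //.
  by rewrite -inverted_value_pair.
- by rewrite /inverted /=; have := ltn_ord y'; lia.
- by rewrite /inverted extendVR extendVL /=; have := ltn_ord ((w^-1)%g v'); lia.
- by rewrite /inverted !extendVR /=; lia.
Qed.

End Extend.

Section ReadingOrder.
Variable n : nat.
Implicit Types (q : 'I_n * 'I_n) (P : {set 'I_n * 'I_n}).

Definition reading : seq ('I_n * 'I_n) :=
  [seq (i, k) | i <- enum 'I_n, k <- rev (enum 'I_n)].

Definition reads_before q q' : bool := (q.1 < q'.1) || (q.1 == q'.1) && (q'.2 < q.2).

Definition boxes_in_order P : seq ('I_n * 'I_n) := [seq q <- reading | q \in P].

Lemma pd_wordE P : pd_word P = map (@box_label n) (boxes_in_order P).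
Proof. by []. Qed.

Lemma mem_reading q : q \in reading.
Proof. by case: q => i k; apply/allpairsP; exists (i, k); rewrite ?mem_rev !mem_enum. Qed.

Lemma mem_boxes_in_order P q : (q \in boxes_in_order P) = (q \in P).
Proof. by rewrite mem_filter mem_reading andbT. Qed.

Lemma mem_pd_word P q : q \in P -> box_label q \in pd_word P.
Proof. by move=> qP; rewrite pd_wordE map_f ?mem_boxes_in_order. Qed.

Lemma pairwise_enum_ord : pairwise (fun i j : 'I_n => i < j) (enum 'I_n).
Proof.
rewrite -[pairwise _ _]/(pairwise (relpre val ltn) (enum 'I_n)) -pairwise_map.
by rewrite val_enum_ord -(sorted_pairwise ltn_trans) iota_ltn_sorted.
Qed.

Lemma pairwise_reading : pairwise reads_before reading.
Proof.
have pairwise_rev : pairwise (fun i j : 'I_n => j < i) (rev (enum 'I_n)).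
  have gtn_ord_trans : transitive (fun i j : 'I_n => j < i) by move=> ? ? ? /=; lia.
  have ltn_ord_trans : transitive (fun i j : 'I_n => i < j) by move=> ? ? ? /=; lia.
  rewrite -(sorted_pairwise gtn_ord_trans) rev_sorted.
  by rewrite (sorted_pairwise ltn_ord_trans) pairwise_enum_ord.
rewrite /reading; elim: (enum 'I_n) pairwise_enum_ord (rev _) pairwise_rev => //= i s IH.
move=> /andP[/allP lt_i sorted_s] t sorted_t.
rewrite pairwise_cat IH // pairwise_map andbT; apply/andP; split.
  apply/allrelP => _ _ /mapP[k _ ->] /allpairsP[[i' k'] /= [/lt_i h _ ->]].
  by rewrite /reads_before /= h.
by apply: sub_pairwise sorted_t => k k' /= lt; rewrite /reads_before /= eqxx lt orbT.
Qed.

Lemma reads_before_asym q q' : reads_before q q' -> ~~ reads_before q' q.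
Proof.
case: q q' => [i k] [i' k']; rewrite /reads_before /=.
by case: (eqVneq i i') => [->|_]; rewrite ?eqxx ?ltnn /= ?orbF; lia.
Qed.

Lemma reads_before_irr q : ~~ reads_before q q.
Proof. by apply/negP => h; have := reads_before_asym h; rewrite h. Qed.

Lemma reads_before_total q q' : [\/ q = q', reads_before q q' | reads_before q' q].
Proof.
case: q q' => [i k] [i' k']; rewrite /reads_before /=.
case: (ltngtP i i') => [_|_|/ord_inj ->]; [exact: Or32|exact: Or33|rewrite eqxx /=].
by case: (ltngtP k k') => [_|_|/ord_inj ->]; [exact: Or33|exact: Or32|exact: Or31].
Qed.

Lemma uniq_reading : uniq reading.
Proof.
by apply: (@pairwise_uniq _ reads_before) pairwise_reading => q;
  apply/negbTE/reads_before_irr.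
Qed.

Lemma uniq_boxes_in_order P : uniq (boxes_in_order P).
Proof. exact: filter_uniq uniq_reading. Qed.

Lemma size_pd_word P : size (pd_word P) = #|P|.
Proof.
rewrite pd_wordE size_map -(card_uniqP (uniq_boxes_in_order P)).
by apply: eq_card => q; rewrite mem_boxes_in_order.
Qed.

Lemma pairwise_boxes_in_orderP P (r : rel ('I_n * 'I_n)) :
  reflect {in P &, forall q q', reads_before q q' -> r q q'}
    (pairwise r (boxes_in_order P)).
Proof.
have sorted_P : pairwise reads_before (boxes_in_order P) :=
  pairwise_filter _ pairwise_reading.
apply: (iffP idP) => [pairwise_r q q' qP q'P lt|r_P]; last first.
  apply: (@sub_in_pairwise _ (mem P) reads_before) sorted_P => //.
  by apply/allP => q; rewrite mem_boxes_in_order.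
have := conj sorted_P pairwise_r => /andP; rewrite -pairwise_relI => /(pairwiseP q) nth_r.
set L := boxes_in_order P in nth_r.
have [iq iq'] : index q L < size L /\ index q' L < size L.
  by rewrite !index_mem !mem_boxes_in_order.
have nthq : nth q L (index q L) = q by rewrite nth_index ?mem_boxes_in_order.
have nthq' : nth q L (index q' L) = q' by rewrite nth_index ?mem_boxes_in_order.
case: (ltngtP (index q L) (index q' L)) => [ltq|ltq|e].
- by have := nth_r _ _ iq iq' ltq; rewrite nthq nthq' => /andP[].
- by have := nth_r _ _ iq' iq ltq; rewrite nthq nthq' /= (negPf (reads_before_asym lt)).
- by move: lt; rewrite -nthq -nthq' e (negPf (reads_before_irr _)).
Qed.

End ReadingOrder.

Section DemazureProduct.
Variable n : nat.
Implicit Types (q : 'I_n * 'I_n) (P : {set 'I_n * 'I_n}) (w : 'S_n).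

Lemma word_extend_lt (u : 'S_(n + n)) (s : seq 'I_(n + n).-1) w :
  foldl (@hecke_mul (n + n)) u s = extend w -> all (fun l : 'I_(n + n).-1 => l < n.-1) s.
Proof.
elim: s u => //= l s IH u word_s; rewrite (IH _ word_s) andbT ltnNge; apply/negP => nl.
set u' := hecke_mul u l in word_s.
have inverted_lt y x : inverted u' y x -> y < n /\ x < n.
  move=> yx; have /inverted_extendP[b _ [-> ->]] : inverted (extend w) y x.
    by rewrite -word_s inverted_foldl yx.
  by rewrite /= !ltn_ord.
have [_ lt_n] := inverted_lt _ _ (inverted_crossing u l).
have [_ e] := hecke_mul_crossing u l; move: lt_n; rewrite -e not_inverted_fix => /= [|x|x].
- by lia.
- by apply/negP => /inverted_lt[/=]; lia.
- by apply/negP => /inverted_lt[_ /=]; lia.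
Qed.

Definition staircase : seq ('I_n * 'I_n) :=
  [seq q : 'I_n * 'I_n <- reading n | q.1 + q.2 < n.-1].

Lemma mem_staircase q : (q \in staircase) = (q.1 + q.2 < n.-1).
Proof. by rewrite mem_filter mem_reading andbT. Qed.

Lemma demazure_staircase P w : demazure P = extend w -> P \subset [set q in staircase].
Proof.
move=> /word_extend_lt/allP lt; apply/subsetP => q qP.
by rewrite inE mem_staircase; apply: (lt (box_label q)); apply: mem_pd_word.
Qed.

Lemma demazure_id P : demazure P = extend (1%g : 'S_n) -> P = set0.
Proof.
rewrite extend1 => /foldl_hecke_mul_eq1 e.
by apply/eqP; rewrite -cards_eq0 -size_pd_word e.
Qed.

Lemma demazure_rothe_leq P w : demazure P = extend w -> #|rothe w| <= #|P|.
Proof.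
move=> word_P; rewrite -(size_pd_word P) -(size_crossings 1) cardE -(size_map (value_pair w)).
apply: uniq_leq_size; first by rewrite (map_inj_uniq (@value_pair_inj n w)) enum_uniq.
move=> _ /mapP[b + ->]; rewrite mem_enum -inverted_value_pair -word_P.
by rewrite inverted_foldl1.
Qed.

Lemma demazure_w0 P : demazure P = extend (w0 n) -> P = rothe (w0 n).
Proof.
move=> word_P; apply/eqP; rewrite eqEcard demazure_rothe_leq // andbT.
apply: subset_trans (demazure_staircase word_P) _; apply/subsetP => q.
by rewrite inE mem_staircase rothe_w0.
Qed.

End DemazureProduct.

Lemma exists_map (T : eqType) (U : Type) (d : T -> U) (s : seq T) (t : seq U) :
  uniq s -> size t = size s -> exists f, t = map f s.
Proof.
elim: s t => [|x s IH] [|y t] //=.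
move=> /andP[xs uniq_s] [/(IH _ uniq_s)[f ->]]; exists (fun z => if z == x then y else f z).
rewrite eqxx; congr cons; apply/eq_in_map => z zs.
by case: eqP => // zx; rewrite -zx zs in xs.
Qed.

Section Labellings.
Variables (n : nat) (w : 'S_n).
Hypothesis avoidw : avoids321 w.
Let avoidW : avoids321 (extend w) := avoids321_extend avoidw.
Implicit Types (i j r k : 'I_n) (b q : 'I_n * 'I_n) (P : {set 'I_n * 'I_n}) (T : filling n).

Definition box_letter b : nat := crossing_letter (extend w) (value_pair w b).

Lemma box_letterE i j : (i, j) \in rothe w ->
  box_letter (i, j) = i + #|[set j' : 'I_n | (j' < j) && ((i, j') \in rothe w)]|.
Proof.
rewrite -inverted_value_pair => ij; rewrite /box_letter /value_pair crossing_letter_row //.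
rewrite extendVL permK /=; congr (_ + _); rewrite -(card_imset _ (@lshift_inj n n)).
apply: eq_card => x; rewrite !inE; apply/andP/imsetP => [[xj]|[j' + ->]].
  move=> /inverted_extendP[[i' j'] bw [/ord_inj/perm_inj /= ei ex]].
  by exists j' => //; rewrite inE ei bw andbT -[_ < j]/(lshift n j' < j) -ex.
by rewrite inE -inverted_value_pair => /andP[].
Qed.

Lemma rothe_col_mono i i' j : (i, j) \in rothe w -> (i', j) \in rothe w ->
  (w i < w i') = (i < i').
Proof.
wlog lt : i i' / i < i' => [wlog_lt|].
  case: (ltngtP i i') => [lt|lt|/ord_inj ->]; rewrite ?ltnn // => iw i'w.
    by rewrite wlog_lt.
  by apply/negbTE; rewrite -leqNgt ltnW // wlog_lt.
rewrite lt !in_rothe => /andP[ji _] /andP[ji' i'j]; rewrite ltnNge; apply/negP => le.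
apply: avoidw; exists i, i', ((w^-1)%g j); rewrite permKV; split=> //.
by rewrite ltn_neqAle le andbT; apply: contraTneq lt => /ord_inj/perm_inj ->; rewrite ltnn.
Qed.

Lemma box_letter_lt_row i j j' : (i, j) \in rothe w -> (i, j') \in rothe w -> j < j' ->
  box_letter (i, j) < box_letter (i, j').
Proof.
move=> ij ij' lt; rewrite !box_letterE // ltn_add2l.
by apply: (@card_ord_sep_lt _ (fun j0 => (i, j0) \in rothe w) j); rewrite ?leqnn.
Qed.

Lemma box_letter_lt_col i i' j : (i, j) \in rothe w -> (i', j) \in rothe w -> i < i' ->
  box_letter (i, j) < box_letter (i', j).
Proof.
move=> ij i'j; rewrite -(rothe_col_mono ij i'j) => lt.
rewrite -inverted_value_pair in ij.
exact: (@crossing_letter_lt_col _ _ _ (lshift n (w i')) _ ij lt).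
Qed.

Lemma box_letter_lt_SE i i' j j' : (i, j) \in rothe w -> (i', j') \in rothe w ->
  i < i' -> j < j' -> box_letter (i, j) < box_letter (i', j').
Proof.
rewrite -!inverted_value_pair => ij ij' ii jj.
by apply: (crossing_letter_lt_SE avoidW ij ij'); rewrite //= !extendVL !permK.
Qed.

Lemma box_letter_bounds b : b \in rothe w -> b.1 <= box_letter b < n.-1.
Proof.
case: b => i j bw; apply/andP; split; first by rewrite box_letterE // leq_addr.
rewrite -inverted_value_pair in bw.
have := crossing_letter_between avoidW bw; rewrite -surjective_pairing -/(box_letter _) /=.
by have := ltn_ord (w i); lia.
Qed.

Lemma box_letter_leftmost i j : (i, j) \in rothe w ->
  (forall j', (i, j') \in rothe w -> j <= j') -> box_letter (i, j) = i.
Proof.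
move=> ij min_j; rewrite box_letterE // [X in #|pred_of_set X|](_ : _ = set0).
  by rewrite cards0 addn0.
by apply/setP => j'; rewrite inE in_set0; apply/negP => /andP[lt /min_j]; rewrite leqNgt lt.
Qed.

Lemma crossing_order_value_pair b c : b \in rothe w -> c \in rothe w ->
  crossing_order (value_pair w b) (value_pair w c) = crossing_order b c.
Proof.
case: b c => [i j] [i' j'] bw cw; rewrite /crossing_order /=.
rewrite !(inj_eq (@lshift_inj n n)) (inj_eq perm_inj); congr (_ && ~~ _).
by case: (eqVneq j j') => // ej; subst j'; rewrite (rothe_col_mono cw bw).
Qed.

(* Each cross of a pipe dream is attributed to the box whose values it compares. *)
Definition labelling P (f : 'I_n * 'I_n -> 'I_n * 'I_n) : Prop :=
  [/\ {in P, forall q, f q \in rothe w /\ box_letter (f q) = q.1 + q.2},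
      {in P &, forall q q', reads_before q q' -> crossing_order (f q) (f q')}
    & forall b, b \in rothe w -> exists2 q, q \in P & f q = b].

Let box_pair f q := value_pair w (f q).

Lemma labelling_sorted P f : labelling P f ->
  [/\ forall c, (c \in map (box_pair f) (boxes_in_order P)) = inverted (extend w) c.1 c.2,
      pairwise (@crossing_order _) (map (box_pair f) (boxes_in_order P))
    & map val (pd_word P) = map (crossing_letter (extend w))
      (map (box_pair f) (boxes_in_order P))].
Proof.
move=> [f_letter f_order f_onto]; split.
- move=> [y v]; apply/mapP/inverted_extendP => [[q]|[b /f_onto[q qP <-] ->]].
    by rewrite mem_boxes_in_order => /f_letter[fq _] ->; exists (f q).
  by exists q; rewrite ?mem_boxes_in_order.
- rewrite pairwise_map; apply/pairwise_boxes_in_orderP => q q' qP q'P lt.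
  have [bw _] := f_letter q qP; have [b'w _] := f_letter q' q'P.
  by rewrite /= crossing_order_value_pair // f_order.
- rewrite pd_wordE -!map_comp; apply/eq_in_map => q.
  by rewrite mem_boxes_in_order => /f_letter[_ e]; rewrite /= -e.
Qed.

Lemma labelling_crossings P f : labelling P f ->
  crossings 1 (pd_word P) = map (box_pair f) (boxes_in_order P).
Proof. by case/labelling_sorted => all_W sorted_f; apply: crossings_sorted. Qed.

Lemma labelling_demazure P f : labelling P f -> demazure P = extend w.
Proof. by case/labelling_sorted => all_W sorted_f; apply: sorted_word. Qed.

Lemma labelling_inj P f f' : labelling P f -> labelling P f' -> {in P, f =1 f'}.
Proof.
move=> /labelling_crossings fE /labelling_crossings; rewrite fE => /eq_in_map e q qP.
by apply: (@value_pair_inj n w); rewrite [LHS]e ?mem_boxes_in_order.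
Qed.

Lemma exists_labelling P : demazure P = extend w -> exists f, labelling P f.
Proof.
move=> word_P; have sorted_t := pairwise_crossings avoidW word_P.
have letters_t := letters_crossings avoidW word_P.
have [||g tE] := @exists_map _ _ (value_pair w) (boxes_in_order P) (crossings 1 (pd_word P)).
- exact: uniq_boxes_in_order.
- by rewrite size_crossings pd_wordE size_map.
have gW q : q \in P -> exists2 b, b \in rothe w & g q = value_pair w b.
  move=> qP; have : g q \in crossings 1 (pd_word P) by rewrite tE map_f ?mem_boxes_in_order.
  rewrite -inverted_foldl1 [foldl _ _ _]word_P => /inverted_extendP[b bw e].
  by exists b; rewrite // -e -surjective_pairing.
have /fin_all_exists[f fP] q : exists b, q \in P -> b \in rothe w /\ g q = value_pair w b.
  by case: (boolP (q \in P)) => [/gW[b bw e]|_]; [exists b | exists q].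
exists f; split=> [q qP|q q' qP q'P lt|b].
- have [fq gq] := fP _ qP; split=> //; move: letters_t; rewrite tE pd_wordE -!map_comp.
  by move/eq_in_map/(_ q); rewrite mem_boxes_in_order /= gq => /(_ qP).
- have [fq gq] := fP _ qP; have [fq' gq'] := fP _ q'P.
  rewrite -crossing_order_value_pair // -gq -gq'.
  by move: q q' qP q'P lt {fq gq fq' gq'}; apply/pairwise_boxes_in_orderP;
    rewrite -pairwise_map -tE.
- rewrite -inverted_value_pair -word_P inverted_foldl1 tE => /mapP[q].
  rewrite mem_boxes_in_order => qP e; exists q => //.
  by have [_ gq] := fP _ qP; apply: (@value_pair_inj n w); rewrite -gq -e.
Qed.

Section PipeDreamOfTableau.
Variable T : filling n.
Hypothesis tabT : tableau (rothe w) T.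

(* Equal letters lie on an antidiagonal, whose NW corner separates the entries. *)
Lemma tableau_letter_inj r b b' :
  r \in T b -> r \in T b' -> box_letter b = box_letter b' -> b = b'.
Proof.
case: b b' => [i j] [i' j']; wlog lt : i j i' j' / i <= i'.
  move=> wlog_le h h' e; case: (leqP i i') => ii; first exact: wlog_le.
  by symmetry; apply: wlog_le => //; apply: ltnW.
move=> h h' e; have bw := tableau_shape tabT h; have bw' := tableau_shape tabT h'.
case: (ltngtP i i') lt => // [lt _|/ord_inj ei _].
  case: (ltngtP j j') => [jj|jj|/ord_inj ej].
  - by have := box_letter_lt_SE bw bw' lt jj; rewrite e ltnn.
  - have [ij' _] := rothe_skew avoidw lt jj bw bw'; have [t ht] := tableau_exists tabT ij'.
    by have := tableau_row tabT jj ht h; have := tableau_col tabT lt ht h'; ord_lia.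
  - by subst j'; have := box_letter_lt_col bw bw' lt; rewrite e ltnn.
subst i'; case: (ltngtP j j') => [jj|jj|/ord_inj -> //].
- by have := box_letter_lt_row bw bw' jj; rewrite e ltnn.
- by have := box_letter_lt_row bw' bw jj; rewrite e ltnn.
Qed.

Definition pipe_dream : {set 'I_n * 'I_n} :=
  [set q : 'I_n * 'I_n | [exists b, (q.1 \in T b) && (box_letter b == q.1 + q.2)]].

Lemma pipe_dreamP q :
  reflect (exists2 b, q.1 \in T b & box_letter b = q.1 + q.2) (q \in pipe_dream).
Proof.
rewrite inE; apply: (iffP existsP) => [[b /andP[? /eqP]]|[b h e]]; exists b => //.
by rewrite h e eqxx.
Qed.

Lemma pipe_dream_entry r b :
  r \in T b -> exists2 k, (r, k) \in pipe_dream & box_letter b = r + k.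
Proof.
move=> rT; have /andP[b1_le lt_n] := box_letter_bounds (tableau_shape tabT rT).
have rb : r <= b.1 by case: b rT {b1_le lt_n} => i j; apply: (tableau_flag tabT).
have kn : box_letter b - r < n by ord_lia.
have e : box_letter b = r + Ordinal kn by rewrite /= subnKC // (leq_trans rb).
by exists (Ordinal kn) => //; apply/pipe_dreamP; exists b.
Qed.

(* The default value is never used on [pipe_dream]. *)
Definition pipe_dream_box q : 'I_n * 'I_n :=
  odflt q [pick b | (q.1 \in T b) && (box_letter b == q.1 + q.2)].

Lemma pipe_dream_boxP q : q \in pipe_dream ->
  q.1 \in T (pipe_dream_box q) /\ box_letter (pipe_dream_box q) = q.1 + q.2.
Proof.
move=> /pipe_dreamP[b h e]; rewrite /pipe_dream_box.
by case: pickP => [b' /andP[? /eqP]|/(_ b)] //=; rewrite h e eqxx.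
Qed.

Lemma pipe_dream_boxE q b : q.1 \in T b -> box_letter b = q.1 + q.2 -> pipe_dream_box q = b.
Proof.
move=> h e; have qP : q \in pipe_dream by apply/pipe_dreamP; exists b.
have [h' e'] := pipe_dream_boxP qP.
by apply: (tableau_letter_inj h' h); rewrite e e'.
Qed.

Lemma pipe_dream_labelling : labelling pipe_dream pipe_dream_box.
Proof.
split=> [q qP|q q' qP q'P lt|b bw].
- by have [h e] := pipe_dream_boxP qP; split=> //; apply: tableau_shape h.
- have [h e] := pipe_dream_boxP qP; have [h' e'] := pipe_dream_boxP q'P.
  case: (pipe_dream_box q) (pipe_dream_box q') h e h' e' => [i j] [i' j'] h e h' e'.
  have bw := tableau_shape tabT h; have bw' := tableau_shape tabT h'.
  apply/andP; split; apply/negP => /andP[/eqP /= eb ltb]; subst.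
    have := tableau_row tabT ltb h h'; have := box_letter_lt_row bw bw' ltb; rewrite e e'.
    case/orP: lt => [|/andP[/eqP <-]]; ord_lia.
  have := tableau_col tabT ltb h' h; have := box_letter_lt_col bw' bw ltb; rewrite e e'.
  by case/orP: lt => [|/andP[/eqP <-]]; ord_lia.
- have [r rT] := tableau_exists tabT bw; have [k kP e] := pipe_dream_entry rT.
  by exists (r, k) => //; apply: pipe_dream_boxE.
Qed.

Lemma demazure_pipe_dream : demazure pipe_dream = extend w.
Proof. exact: labelling_demazure pipe_dream_labelling. Qed.

Lemma card_entries_pipe_dream r : wt pipe_dream r = #|[set b | r \in T b]|.
Proof.
rewrite mnmE; pose col b : 'I_n := insubd r (box_letter b - r).
have colE b k : box_letter b = r + k -> k < n -> col b = k :> nat.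
  by move=> e kn; rewrite /col val_insubd e addKn kn.
have col_inj : {in [set b | r \in T b] &, injective col}.
  move=> b b'; rewrite !inE => h h' e; apply: (tableau_letter_inj h h').
  have [k _ ek] := pipe_dream_entry h; have [k' _ ek'] := pipe_dream_entry h'.
  by rewrite ek ek' -(colE _ _ ek) // -(colE _ _ ek') // e.
rewrite -(card_in_imset col_inj); apply: eq_card => k; rewrite inE.
apply/pipe_dreamP/imsetP => /= [[b h e]|[b]].
  by exists b; rewrite ?inE //; apply: ord_inj; rewrite (colE _ _ e).
by rewrite inE => h ->; have [k' _ e] := pipe_dream_entry h; exists b; rewrite ?(colE _ _ e).
Qed.

Lemma card_entries_diagram r : wt (boxes (diagram_of T)) r = #|[set b | r \in T b]|.
Proof.
rewrite mnmE.
have snd_inj : {in [set b | r \in T b] &, injective (fun b : 'I_n * 'I_n => b.2)}.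
  move=> [i j] [i' j']; rewrite !inE => h h' /= e; subst j'.
  by rewrite (tableau_col_inj tabT h h').
rewrite -(card_in_imset snd_inj); apply: eq_card => j; rewrite [LHS]inE.
apply/diagram_of_boxP/imsetP => [[i h]|[[i j'] + ->]]; first by exists (i, j); rewrite ?inE.
by rewrite inE; exists i.
Qed.

Lemma wt_pipe_dream : wt pipe_dream = wt (boxes (diagram_of T)).
Proof. by apply/mnmP => r; rewrite card_entries_pipe_dream card_entries_diagram. Qed.

End PipeDreamOfTableau.

Lemma pipe_dream_inj : {in tableaux (rothe w) &, injective pipe_dream}.
Proof.
apply: filling_injective => T T'; rewrite !inE => tabT tabT' e b; apply/subsetP => r rT.
have [k kT letter_b] := pipe_dream_entry tabT rT.
have := pipe_dream_labelling tabT'; rewrite -e => label'.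
have := labelling_inj (pipe_dream_labelling tabT) label' kT.
rewrite (@pipe_dream_boxE T tabT (r, k) b rT letter_b) => ->.
by rewrite e in kT; have [] := pipe_dream_boxP kT.
Qed.

Section TableauOfLabelling.
Variables (P : {set 'I_n * 'I_n}) (f : 'I_n * 'I_n -> 'I_n * 'I_n).
Hypothesis label_f : labelling P f.

Definition tableau_of : filling n :=
  [ffun b => [set r | [exists k, ((r, k) \in P) && (f (r, k) == b)]]].

Lemma tableau_ofP r b : reflect (exists2 k, (r, k) \in P & f (r, k) = b) (r \in tableau_of b).
Proof.
rewrite ffunE inE.
by apply: (iffP existsP) => [[k /andP[kP /eqP e]]|[k kP e]]; exists k; rewrite // kP e eqxx.
Qed.

Let letter_f r k b : (r, k) \in P -> f (r, k) = b -> b \in rothe w /\ box_letter b = r + k.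
Proof. by move=> kP <-; have [/(_ _ kP)] := label_f. Qed.

Lemma tableau_of_neq0 b : (tableau_of b != set0) = (b \in rothe w).
Proof.
have [_ _ f_onto] := label_f; apply/set0Pn/idP =>
  [[r /tableau_ofP[k kP /(letter_f kP)[]]] //|].
by move=> /f_onto[[r k] kP e]; exists r; apply/tableau_ofP; exists k.
Qed.

Lemma tableau_of_row i j j' r s : j < j' -> r \in tableau_of (i, j) ->
  s \in tableau_of (i, j') -> s <= r.
Proof.
move=> jj /tableau_ofP[k rk e] /tableau_ofP[k' sk e']; have [_ f_order _] := label_f.
case: (reads_before_total (r, k) (s, k')) =>
  [[-> _] //|lt|/orP[/ltnW //|/andP[/eqP /= -> //]]].
by have := f_order _ _ rk sk lt; rewrite e e' /crossing_order /= eqxx jj.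
Qed.

Lemma tableau_of_col i i' j r s : i < i' -> r \in tableau_of (i, j) ->
  s \in tableau_of (i', j) -> r < s.
Proof.
move=> ii /tableau_ofP[k rk e] /tableau_ofP[k' sk e']; have [_ f_order _] := label_f.
have [bw letter_r] := letter_f rk e; have [bw' letter_s] := letter_f sk e'.
have := box_letter_lt_col bw bw' ii; rewrite letter_r letter_s => lt.
case: (reads_before_total (r, k) (s, k')) => [[er ek]|/orP[//|/andP[/eqP /= er kk]]|].
- by rewrite er ek ltnn in lt.
- by rewrite er in lt; move: lt kk; ord_lia.
- by move/(f_order _ _ sk rk); rewrite e e' /crossing_order /= eqxx ii /= andbF.
Qed.

Lemma tableau_of_flag i j r : r \in tableau_of (i, j) -> r <= i.
Proof.
move=> rT; have ij : (i, j) \in rothe w by rewrite -tableau_of_neq0; apply/set0Pn; exists r.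
have [j0 ij0 min_j0] := @arg_minnP _ j (fun j' => (i, j') \in rothe w) (@nat_of_ord n) ij.
have [r0 r0T rr0] : exists2 r0, r0 \in tableau_of (i, j0) & r <= r0.
  case: (ltngtP j0 j) (min_j0 _ ij) => // [jj _|/ord_inj -> _]; last by exists r.
  move: ij0; rewrite -tableau_of_neq0 => /set0Pn[r0 r0T]; exists r0 => //.
  exact: tableau_of_row jj r0T rT.
have /tableau_ofP[k r0P e] := r0T; have [_] := letter_f r0P e.
by rewrite (box_letter_leftmost ij0 min_j0); ord_lia.
Qed.

Lemma tableau_tableau_of : tableau (rothe w) tableau_of.
Proof.
apply/tableauP; split.
- exact: tableau_of_neq0.
- exact: tableau_of_row.
- exact: tableau_of_col.
- exact: tableau_of_flag.
Qed.

Lemma pipe_dream_tableau_of : pipe_dream tableau_of = P.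
Proof.
apply/setP => -[r k]; apply/pipe_dreamP/idP => /= [[b /tableau_ofP[k' rk' e] letter_b]|rk].
  by have [_] := letter_f rk' e; rewrite letter_b => /addnI/ord_inj ->.
have [_ letter_b] := letter_f rk erefl.
by exists (f (r, k)) => //; apply/tableau_ofP; exists k.
Qed.

End TableauOfLabelling.

Lemma pipe_dreams_tableaux :
  [set P | demazure P == extend w] = [set pipe_dream T | T in tableaux (rothe w)].
Proof.
apply/setP => P; rewrite inE; apply/eqP/imsetP => [/exists_labelling[f label_f]|[T + ->]].
  by exists (tableau_of P f); rewrite ?inE ?tableau_tableau_of ?pipe_dream_tableau_of.
by rewrite inE; apply: demazure_pipe_dream.
Qed.

End Labellings.

(** * 0-Hecke operators *)

Local Open Scope ring_scope.

Section HeckeAction.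
Variable m : nat.
Implicit Types (u : 'S_m) (l : 'I_m.-1) (x : 'I_m) (k : nat).

Lemma val_hecke_mul u l x : hecke_mul u l x =
  (if x == sleft l then maxn (u (sleft l)) (u (sright l))
   else if x == sright l then minn (u (sleft l)) (u (sright l)) else u x) :> nat.
Proof.
have rl : (sright l == sleft l) = false by rewrite eq_sym (negPf (sleft_neq_sright l)).
rewrite hecke_mulE; case: (asc_or_desc u l) => h.
  rewrite h rmul_simpleE /simple (maxn_idPr (ltnW h)) (minn_idPl (ltnW h)).
  by case: tpermP => [->|->|/eqP/negPf-> /eqP/negPf->]; rewrite ?rl ?eqxx.
rewrite ltnNge (ltnW h) /= (maxn_idPl (ltnW h)) (minn_idPr (ltnW h)).
by case: eqP => [->|_] //; case: eqP => [->|].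
Qed.

(* Letters out of range act trivially. *)
Definition hecke_act u k : 'S_m := if insub k is Some l then hecke_mul u l else u.

Lemma hecke_act_ord u l : hecke_act u l = hecke_mul u l.
Proof. by rewrite /hecke_act valK. Qed.

Lemma hecke_act_out k u : (m.-1 <= k)%N -> hecke_act u k = u.
Proof. by move=> mk; rewrite /hecke_act insubF // ltnNge mk. Qed.

Lemma hecke_act_id u k : hecke_act (hecke_act u k) k = hecke_act u k.
Proof.
case: (ltnP k m.-1) => [km|mk]; last by rewrite !hecke_act_out.
rewrite -[k]/(val (Ordinal km)) !hecke_act_ord; move: (Ordinal km) => l.
apply/permP => x; apply: val_inj => /=; rewrite !val_hecke_mul !eqxx.
have -> : (sright l == sleft l) = false by rewrite eq_sym (negPf (sleft_neq_sright l)).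
by case: eqP => // _; [lia | case: eqP => // _; lia].
Qed.

Lemma hecke_act_comm u k k' : (k.+1 < k')%N ->
  hecke_act (hecke_act u k) k' = hecke_act (hecke_act u k') k.
Proof.
move=> kk'; case: (ltnP k m.-1) => [km|mk]; last by rewrite !(hecke_act_out _ mk).
case: (ltnP k' m.-1) => [k'm|mk']; last by rewrite !(hecke_act_out _ mk').
move: kk'; rewrite -[k]/(val (Ordinal km)) -[k']/(val (Ordinal k'm)) !hecke_act_ord.
move: (Ordinal km) (Ordinal k'm) => l l' /= ll'.
apply/permP => x; apply: val_inj => /=; rewrite !val_hecke_mul.
have [ll rl lr rr] : [/\ (sleft l == sleft l') = false, (sright l == sleft l') = false,
    (sleft l == sright l') = false & (sright l == sright l') = false].
  by split; rewrite -val_eqE /=; lia.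
rewrite ![sleft l' == _]eq_sym ![sright l' == _]eq_sym ll rl lr rr.
case: (eqVneq x (sleft l)) => [->|_]; first by rewrite ll lr.
by case: (eqVneq x (sright l)) => [->|_]; rewrite ?rl ?rr.
Qed.

Lemma hecke_act_braid u k : (k.+1 < m.-1)%N ->
  hecke_act (hecke_act (hecke_act u k) k.+1) k
    = hecke_act (hecke_act (hecke_act u k.+1) k) k.+1.
Proof.
move=> k1m; have km : (k < m.-1)%N by lia.
pose l := Ordinal km; pose l' := Ordinal k1m.
rewrite -[k.+1]/(val l') -[k]/(val l) !hecke_act_ord.
have middle : sleft l' = sright l by apply: val_inj.
have [lm lr mr] : [/\ (sleft l == sright l) = false, (sleft l == sright l') = false
    & (sright l == sright l') = false] by split; rewrite -val_eqE /=; lia.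
apply/permP => x; apply: val_inj => /=; rewrite !val_hecke_mul middle.
rewrite ![sright l' == _]eq_sym ![sright l == sleft l]eq_sym lm lr mr !eqxx.
case: (eqVneq x (sleft l)) => [->|_]; first by rewrite ?lm ?lr; lia.
case: (eqVneq x (sright l)) => [_|_]; first by lia.
by case: (eqVneq x (sright l')) => // _; lia.
Qed.

End HeckeAction.

Section HeckeFactors.
Variables (m : nat) (R : comNzRingType).
Local Notation F := {ffun 'S_m -> R^o}.
Implicit Types (u : 'S_m) (f g : F) (x y a b : R) (k d i : nat).

Definition hecke_factor k x f : F := [ffun u => (f u : R) - x * f (hecke_act u k)].

Lemma hecke_factorE k x f u :
  hecke_factor k x f u = f u - x * f (hecke_act u k) :> R.
Proof. by rewrite ffunE. Qed.

Fact hecke_factor_is_linear k x : linear (hecke_factor k x).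
Proof. by move=> a f g; apply/ffunP => u; rewrite !ffunE /GRing.scale /=; ring. Qed.

HB.instance Definition _ k x :=
  GRing.isLinear.Build R F F *:%R (hecke_factor k x) (hecke_factor_is_linear k x).

(* The inverse of [hecke_factor k x], multiplied by [1 - x]. *)
Definition hecke_cofactor k x f : F := [ffun u => (1 - x) * f u + x * f (hecke_act u k)].

Lemma hecke_cofactorE k x f u :
  hecke_cofactor k x f u = (1 - x) * f u + x * f (hecke_act u k) :> R.
Proof. by rewrite ffunE. Qed.

Lemma hecke_factorK k x f : hecke_factor k x (hecke_cofactor k x f) = (1 - x) *: f.
Proof. by apply/ffunP => u; rewrite !ffunE hecke_act_id /GRing.scale /=; ring. Qed.

Lemma hecke_factor_comm k k' x y f : (k.+1 < k')%N ->
  hecke_factor k x (hecke_factor k' y f) = hecke_factor k' y (hecke_factor k x f).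
Proof.
by move=> lt; apply/ffunP => u; rewrite !hecke_factorE (hecke_act_comm u lt); ring.
Qed.

Definition braid_factor k x y f : F :=
  hecke_factor k x (hecke_factor k.+1 y (hecke_factor k y f)).

Lemma yang_baxter k x y f u : (k.+1 < m.-1)%N ->
  (1 - x) * hecke_cofactor k.+1 y (braid_factor k x y f) u =
  (1 - y) * hecke_cofactor k.+1 x (braid_factor k y x f) u :> R.
Proof.
move=> km; rewrite !hecke_cofactorE /braid_factor !hecke_factorE.
rewrite -!(hecke_act_braid _ km) !hecke_act_id -?(hecke_act_braid _ km) ?hecke_act_id.
ring.
Qed.

(* The product of the factors of the letters i+d-1, ..., i, in this order. *)
Fixpoint row_factor d i x f : F :=
  if d is d'.+1 then row_factor d' i.+1 x (hecke_factor i x f) else f.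

Fact row_factor_is_linear d i x : linear (row_factor d i x).
Proof. by elim: d i => // d IH i a f g; rewrite /= linearP IH. Qed.

HB.instance Definition _ d i x :=
  GRing.isLinear.Build R F F *:%R (row_factor d i x) (row_factor_is_linear d i x).

Lemma hecke_factor_row_factor k d i x y f : (k.+1 < i)%N ->
  hecke_factor k x (row_factor d i y f) = row_factor d i y (hecke_factor k x f).
Proof.
elim: d i f => //= d IH i f ki; rewrite IH; last by lia.
by rewrite hecke_factor_comm.
Qed.

Lemma ffun_scalerI a f g : GRing.lreg a -> a *: f = a *: g -> f = g.
Proof.
move=> reg_a /ffunP e; apply/ffunP => u; apply: reg_a.
by have := e u; rewrite !ffunE.
Qed.

Lemma row_factor_comm d i x y f :
  GRing.lreg (1 - x) -> GRing.lreg (1 - y) -> (i + d <= m.-1)%N ->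
  row_factor d i x (row_factor d i y f) = row_factor d i y (row_factor d i x f).
Proof.
move=> reg_x reg_y; elim: d i f => [//|[|d] IH] i f di.
  by apply/ffunP => u; rewrite /= !hecke_factorE !hecke_act_id; ring.
have km : (i.+1 < m.-1)%N by lia.
have clear_denominators a b :
    ((1 - a) * (1 - b)) *: row_factor d.+2 i a (row_factor d.+2 i b f) =
    row_factor d.+1 i.+1 a (row_factor d.+1 i.+1 b
      ((1 - a) *: hecke_cofactor i.+1 b (braid_factor i a b f))).
  rewrite !linearZ /= hecke_factorK !linearZ /= scalerA mulrC; congr (_ *: _).
  by rewrite hecke_factor_row_factor.
apply: (@ffun_scalerI ((1 - x) * (1 - y))); first exact: lregM.
have swap : (1 - x) *: hecke_cofactor i.+1 y (braid_factor i x y f) =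
    (1 - y) *: hecke_cofactor i.+1 x (braid_factor i y x f).
  by apply/ffunP => u; rewrite [LHS]ffunE [RHS]ffunE; apply: yang_baxter.
rewrite clear_denominators swap IH; last by lia.
by rewrite -clear_denominators mulrC.
Qed.

(* The rows r, r+1, ... of a pipe dream, restricted to the letters below [M]. *)
Fixpoint rows_factor (M r : nat) (xs : seq R) f : F :=
  if xs is x :: xs' then row_factor (M - r) r x (rows_factor M r.+1 xs' f) else f.

Fact rows_factor_is_linear M r xs : linear (rows_factor M r xs).
Proof. by elim: xs r => // x xs IH r a f g; rewrite /= IH linearP. Qed.

HB.instance Definition _ M r xs :=
  GRing.isLinear.Build R F F *:%R (rows_factor M r xs) (rows_factor_is_linear M r xs).

Lemma rows_factor_cat M r xs ys f :
  rows_factor M r (xs ++ ys) f = rows_factor M r xs (rows_factor M (r + size xs) ys f).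
Proof. by elim: xs r => [|x xs IH] r /=; rewrite ?addn0 // IH addSnnS. Qed.

Lemma hecke_factor_rows_factor M k x r xs f : (k.+1 < r)%N ->
  hecke_factor k x (rows_factor M r xs f) = rows_factor M r xs (hecke_factor k x f).
Proof.
by elim: xs r => //= y xs IH r kr; rewrite hecke_factor_row_factor // IH //; lia.
Qed.

Lemma rows_factor_swap M xs x y ys f : GRing.lreg (1 - x) -> GRing.lreg (1 - y) ->
  (size xs < M)%N -> (M <= m.-1)%N ->
  rows_factor M 0 (xs ++ x :: y :: ys) (hecke_factor (size xs) y f) =
  rows_factor M 0 (xs ++ y :: x :: ys) (hecke_factor (size xs) x f).
Proof.
move=> reg_x reg_y iM Mm; rewrite !rows_factor_cat /= add0n -!hecke_factor_rows_factor //.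
set g := rows_factor _ _ ys f; set i := size xs in iM *.
have row_last a :
  row_factor (M - i.+1) i.+1 a (hecke_factor i a g) = row_factor (M - i) i a g.
  by have -> : (M - i = (M - i.+1).+1)%N by lia.
by rewrite !row_last row_factor_comm //; lia.
Qed.

Lemma row_factor_iota d i x f :
  row_factor d i x f = foldr (fun k => hecke_factor k x) f (rev (iota i d)).
Proof. by elim: d i f => [//|d IH] i f /=; rewrite rev_cons foldr_rcons IH. Qed.

End HeckeFactors.

Lemma big_subset_setU1 (Q : finType) (V : nmodType) (A : {set Q}) q
    (g : {set Q} -> V) : q \notin A ->
  \sum_(P : {set Q} | P \subset q |: A) g P =
  \sum_(P : {set Q} | P \subset A) g P + \sum_(P : {set Q} | P \subset A) g (q |: P).
Proof.
move=> qA; rewrite (bigID (fun P : {set Q} => q \in P)) /= addrC.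
have notin (P : {set Q}) : P \subset A -> q \notin P by move/subsetP => PA;
  apply: contra qA => /PA.
congr (_ + _).
  apply: eq_bigl => P; apply/andP/idP => [[PA qP]|PA]; last first.
    by rewrite notin // (subset_trans PA) ?subsetUr.
  by rewrite -(setU1K qA) subsetD1 PA.
rewrite (reindex_onto (fun P : {set Q} => q |: P) (fun P => P :\ q)) /=; last first.
  by move=> P /andP[_ qP]; rewrite setD1K.
apply: eq_bigl => P; rewrite setU11 andbT; apply/andP/idP => [[qPA /eqP <-]|PA].
  by rewrite -(setU1K qA) setSD.
by rewrite setUS // setU1K ?notin.
Qed.

Section Expansion.
Variables (m : nat) (R : comNzRingType) (Q : finType).
Variables (letter : Q -> 'I_m.-1) (var : Q -> R).
Local Notation F := {ffun 'S_m -> R^o}.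
Implicit Types (f : F) (u : 'S_m) (A P : {set Q}) (L : seq Q).

Definition cross_monomial P : R := \prod_(q in P) (- var q).

Definition letters_in P L : seq 'I_m.-1 := [seq letter q | q <- L & q \in P].

Lemma foldr_hecke_factor L f u : uniq L ->
  foldr (fun q => hecke_factor (letter q) (var q)) f L u =
  \sum_(P : {set Q} | P \subset [set q in L])
    cross_monomial P * f (foldl (@hecke_mul m) u (letters_in P L)).
Proof.
elim: L u => [|q L IH] u /=.
  rewrite (big_pred1 set0) => [_|P]; first by rewrite /cross_monomial big_set0 mul1r.
  by rewrite /= -subset0; congr (_ \subset _); apply/setP => q; rewrite !inE.
move=> /andP[qL uL]; have qA : q \notin [set z in L] by rewrite inE.
rewrite set_cons (big_subset_setU1 _ qA) hecke_factorE hecke_act_ord !IH // mulr_sumr -sumrN.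
have notin P : P \subset [set z in L] -> q \notin P.
  by move/subsetP => PL; apply: contra qL => /PL; rewrite inE.
congr (_ + _); apply: eq_bigr => P /notin qP.
  by rewrite /letters_in /= (negPf qP).
rewrite /cross_monomial big_setU1 //= mulrA !mulNr /letters_in /= setU11 /=.
congr (- (_ * f (foldl _ _ (map _ _)))); apply: eq_in_filter => z zL.
by rewrite in_setU1; case: eqP => // zq; rewrite -zq zL in qL.
Qed.

End Expansion.

(** * Pipe dream formula for Grothendieck polynomials *)

Section AscentInduction.
Variable n : nat.
Implicit Types (w : 'S_n) (q : 'I_n * 'I_n).

Lemma all_desc_w0 w : (forall i, w (sright i) < w (sleft i))%N -> w = w0 n.
Proof.
move=> desc; have e : (w * w0 n = 1)%g.
  apply: no_desc => i; rewrite !permM !permE /=.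
  by have := desc i; have := ltn_ord (w (sleft i)); lia.
apply/permP => x; apply: (@perm_inj _ (w0 n)); have /permP/(_ x) := e.
by rewrite permM perm1 => ->; rewrite !permE rev_ordK.
Qed.

Lemma perm_ascent_ind (Q : 'S_n -> Prop) : Q (w0 n) ->
  (forall w i, (w (sleft i) < w (sright i))%N -> Q (rmul_simple w i) -> Q w) ->
  forall w, Q w.
Proof.
move=> Q0 Q_asc w.
have ninv_le (v : 'S_n) : (ninv v <= n * n)%N
  by rewrite (leq_trans (max_card _)) // card_prod card_ord.
have [k] := ubnP (n * n - ninv w)%N; elim: k w => // k IH w wk.
case: (pickP (fun i => w (sleft i) < w (sright i))%N) => [i asc|no_asc].
  apply: (Q_asc w i asc); apply: IH.
  by have := ninv_le (rmul_simple w i); rewrite (ninv_asc asc); lia.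
suff -> : w = w0 n by [].
by apply: all_desc_w0 => i; have := no_asc i; case: (asc_or_desc w i) => // ->.
Qed.

End AscentInduction.

Section BoxMonomials.
Variable n : nat.
Local Notation R := {mpoly int[n]}.
Implicit Types (P : {set 'I_n * 'I_n}) (i j : 'I_n).

Lemma card_row P i : #|[pred q in P | q.1 == i]| = wt P i.
Proof.
rewrite mnmE; have pair_inj : injective (fun c : 'I_n => (i, c)) by move=> c c' [].
rewrite -(card_imset _ pair_inj); apply: eq_card => -[a c]; rewrite unfold_in /=.
apply/andP/imsetP => [[h /eqP e]|[c' + [-> ->]]]; last by rewrite inE eqxx.
by subst; exists c; rewrite ?inE.
Qed.

Lemma card_wt P : #|P| = mdeg (wt P).
Proof.
rewrite mdegE -sum1_card (partition_big (fun q : 'I_n * 'I_n => q.1) xpredT) //=.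
by apply: eq_bigr => i _; rewrite sum1_card -card_row.
Qed.

Lemma cross_monomialE P :
  cross_monomial (fun q => 'X_(q.1) : R) P = (-1) ^+ #|P| * 'X_[wt P].
Proof.
rewrite /cross_monomial -prodr_const; under eq_bigr do rewrite -mulN1r.
rewrite big_split /=; congr (_ * _); rewrite mpolyXE_id.
rewrite (partition_big (fun q : 'I_n * 'I_n => q.1) xpredT) //=.
apply: eq_bigr => i _; rewrite (eq_bigr (fun _ => 'X_i)) => [|q /andP[_ /eqP->] //].
by rewrite prodr_const -card_row.
Qed.

Lemma mpolyX_sub_neq0 i j : i != j -> 'X_i - 'X_j != 0 :> R.
Proof.
move=> ij; rewrite subr_eq0; apply/negP => /eqP /(congr1 (mcoeff U_(i)%MM)).
by rewrite !mcoeffXU eqxx eq_sym (negPf ij) => /eqP.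
Qed.

Lemma lreg_subr1_mpolyX i : GRing.lreg (1 - 'X_i : R).
Proof.
apply: mulfI; rewrite subr_eq0; apply/negP => /eqP /(congr1 (mcoeff U_(i)%MM)).
by rewrite mcoeff1 mcoeffXU eqxx mnm1_eq0.
Qed.

End BoxMonomials.

Section PipeDreamPolynomials.
Variable n : nat.
Local Notation R := {mpoly int[n]}.
Local Notation m := (n + n)%N.
Local Notation F := {ffun 'S_m -> R^o}.
Implicit Types (f : F) (q : 'I_n * 'I_n) (P : {set 'I_n * 'I_n}) (w : 'S_n) (i : 'I_n.-1).

Lemma pd_word_staircase P : P \subset [set q in staircase n] ->
  pd_word P = letters_in (@box_label n) P (staircase n).
Proof.
move=> /subsetP PS; rewrite pd_wordE /letters_in -filter_predI; congr map.
apply: eq_filter => q /=; case qP: (q \in P) => //=.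
by have := PS _ qP; rewrite inE mem_staircase.
Qed.

Definition row_product f : R := rows_factor n.-1 0 [seq 'X_a : R | a <- enum 'I_n] f 1%g.

Lemma rows_factor_staircase f : rows_factor n.-1 0 [seq 'X_a : R | a <- enum 'I_n] f =
  foldr (fun q => hecke_factor (box_label q) ('X_(q.1) : R)) f (staircase n).
Proof.
suff rows (s : seq 'I_n) r : map val s = iota r (size s) ->
    rows_factor n.-1 r [seq 'X_a : R | a <- s] f =
    foldr (fun q => hecke_factor (box_label q) ('X_(q.1) : R)) f
      [seq q : 'I_n * 'I_n <- [seq (a, k) | a <- s, k <- rev (enum 'I_n)] |
        (q.1 + q.2 < n.-1)%N].
  by apply: rows; rewrite val_enum_ord size_enum_ord.
elim: s r => //= i s IH r [ir es]; rewrite filter_cat foldr_cat -(IH _ es) -ir.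
rewrite row_factor_iota filter_map foldr_map /= filter_rev.
rewrite -(foldr_map (fun k : 'I_n => (i + k)%N) (fun k g => hecke_factor k _ g)) map_rev.
congr (foldr _ _ (rev _)).
rewrite -[X in iota X _]addn0 iotaDl -(@filter_iota_ltn _ n); last by lia.
rewrite -val_enum_ord filter_map -map_comp; congr map.
by apply: eq_filter => k /=; rewrite ltn_subRL.
Qed.

Definition pd_poly w : R :=
  \sum_(P : {set 'I_n * 'I_n} | demazure P == extend w) cross_monomial (fun q => 'X_(q.1)) P.

Definition indicator (V : 'S_m) : F := [ffun u => (u == V)%:R].

Lemma row_product_indicator w : row_product (indicator (extend w)) = pd_poly w.
Proof.
rewrite /row_product rows_factor_staircase foldr_hecke_factor;
  last exact: filter_uniq (uniq_reading n).
rewrite /pd_poly big_mkcond [RHS]big_mkcond; apply: eq_bigr => P _.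
case: ifP => [PS|/negP PS]; last by case: ifP => // /eqP/demazure_staircase.
by rewrite -pd_word_staircase // ffunE; case: eqP => _; rewrite ?mulr1 ?mulr0.
Qed.

Definition msym_ffun (s : 'S_n) f : F := [ffun u => msym s (f u)].

Lemma msym_hecke_factor s k (x : R) f :
  msym_ffun s (hecke_factor k x f) = hecke_factor k (msym s x) (msym_ffun s f).
Proof. by apply/ffunP => u; rewrite !ffunE msymB msymM. Qed.

Lemma msym_rows_factor s M r (xs : seq R) f :
  msym_ffun s (rows_factor M r xs f) = rows_factor M r (map (msym s) xs) (msym_ffun s f).
Proof.
elim: xs r f => //= x xs IH r f; rewrite -IH; move: (rows_factor M r.+1 xs f) => {}f.
by move: (M - r)%N => d; elim: d r f => //= d IHd r f; rewrite IHd msym_hecke_factor.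
Qed.

Lemma msym_indicator s V : msym_ffun s (indicator V) = indicator V.
Proof. by apply/ffunP => u; rewrite !ffunE; case: eqP => _; rewrite ?msym1 ?msym0. Qed.

Lemma enum_ord_adjacent i : enum 'I_n =
  take i (enum 'I_n) ++ sleft i :: sright i :: drop i.+2 (enum 'I_n).
Proof.
rewrite -{1}(cat_take_drop i (enum 'I_n)); congr cat.
have lt := ltn_ord (sright i); have lt' := ltn_ord (sleft i).
rewrite (drop_nth (sleft i)) ?size_enum_ord // (nth_ord_enum _ (sleft i)); congr cons.
by rewrite (drop_nth (sleft i)) ?size_enum_ord // (nth_ord_enum _ (sright i)).
Qed.

Lemma msym_simple_vars i (s : seq 'I_n) : sleft i \notin s -> sright i \notin s ->
  map (msym (simple i)) [seq 'X_a : R | a <- s] = [seq 'X_a | a <- s].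
Proof.
move=> notl notr; rewrite -map_comp; apply/eq_in_map => a a_s /=.
rewrite msym_tpermX /simple tpermD //.
  by apply: contraNneq notl => ->.
by apply: contraNneq notr => ->.
Qed.

(* The two rows i, i+1 followed by the letter i form a symmetric product. *)
Lemma row_product_sym i f : msym_ffun (simple i) f = f ->
  msym (simple i) (row_product (hecke_factor i 'X_(sright i) f))
    = row_product (hecke_factor i 'X_(sright i) f).
Proof.
move=> sym_f; rewrite /row_product; set product := rows_factor _ _ _ _.
have -> : msym (simple i) (product 1%g) = msym_ffun (simple i) product 1%g by rewrite ffunE.
congr (fun_of_fin _ 1%g).
rewrite {}/product msym_rows_factor msym_hecke_factor sym_f msym_simpleR.
have := enum_uniq 'I_n; have := enum_ord_adjacent i.
set s := take _ _; set t := drop _ _ => enumE; rewrite enumE cat_uniq /= !inE !negb_or.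
move=> /and3P[_ /and3P[ls rs _] /and3P[/andP[_ lt] rt _]].
rewrite !map_cat /= (msym_simple_vars ls rs) (msym_simple_vars lt rt).
rewrite msym_simpleL msym_simpleR.
have size_s : size [seq 'X_a : R | a <- s] = i.
  by rewrite size_map size_takel // size_enum_ord; have := ltn_ord i; ord_lia.
have := @rows_factor_swap m R n.-1 [seq 'X_a : R | a <- s] 'X_(sleft i) 'X_(sright i)
  [seq 'X_a : R | a <- t] f (@lreg_subr1_mpolyX _ _) (@lreg_subr1_mpolyX _ _).
by rewrite size_s => -> //; ord_lia.
Qed.

Section AscentRecursion.
Variables (w : 'S_n) (i : 'I_n.-1).
Hypothesis asc : (w (sleft i) < w (sright i))%N.
Let W := extend w.
Let ws := rmul_simple w i.
Let x : R := 'X_(sleft i).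
Let y : R := 'X_(sright i).

Let ascW : (W (sleft (wide_letter i)) < W (sright (wide_letter i)))%N.
Proof. by rewrite sleft_wide sright_wide !extendL. Qed.

Lemma hecke_factor_indicator_ascent : hecke_factor i y (indicator W) = indicator W.
Proof.
apply/ffunP => u; rewrite !ffunE -[nat_of_ord i]/(nat_of_ord (wide_letter i)) hecke_act_ord.
by rewrite hecke_mul_eq_ascent // mulr0 subr0.
Qed.

Lemma hecke_factor_indicator_descent :
  hecke_factor i y (indicator (extend ws)) =
    (1 - y) *: indicator (extend ws) - y *: indicator W.
Proof.
apply/ffunP => u; rewrite !ffunE -[nat_of_ord i]/(nat_of_ord (wide_letter i)) hecke_act_ord.
rewrite extend_rmul_simple -/W hecke_mul_eq_descent // /GRing.scale /=.
case: (eqVneq u W) => [->|_] /=; last by case: (u == _) => /=; ring.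
by rewrite eq_sym (negPf (rmul_simple_neq _ _)) /=; ring.
Qed.

Lemma msym_pd_poly_ascent : msym (simple i) (pd_poly w) = pd_poly w.
Proof.
rewrite -row_product_indicator -/W -hecke_factor_indicator_ascent.
by rewrite row_product_sym // msym_indicator.
Qed.

Lemma pd_poly_rec :
  (x - y) * pd_poly w = (1 - x) * msym (simple i) (pd_poly ws) - (1 - y) * pd_poly ws.
Proof.
have product_ws : row_product (hecke_factor i y (indicator (extend ws))) =
    (1 - y) * pd_poly ws - y * pd_poly w.
  rewrite hecke_factor_indicator_descent -!row_product_indicator /row_product.
  by rewrite linearB !linearZ /= !ffunE /GRing.scale /= mulrN.
have := row_product_sym (msym_indicator (simple i) (extend ws)).
rewrite product_ws msymB !msymM msymB msym1 msym_simpleR msym_pd_poly_ascent -/x => sym_ws.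
transitivity ((1 - x) * msym (simple i) (pd_poly ws) -
   ((1 - x) * msym (simple i) (pd_poly ws) - x * pd_poly w) - y * pd_poly w); first by ring.
by rewrite sym_ws; ring.
Qed.

End AscentRecursion.

Lemma pd_poly1 : pd_poly 1%g = 1.
Proof.
have pd_word0 : pd_word (set0 : {set 'I_n * 'I_n}) = [::].
  by apply/size0nil; rewrite size_pd_word cards0.
rewrite /pd_poly (big_pred1 set0) => [|P]; first by rewrite /cross_monomial big_set0.
apply/eqP/eqP => [/demazure_id //|->].
by rewrite /demazure pd_word0 extend1.
Qed.

(* Otherwise no pipe dream would give [w0], and by the recursion all the pipe dream
   polynomials would vanish, including that of the identity. *)
Lemma demazure_rothe_w0 : demazure (rothe (w0 n)) = extend (w0 n).
Proof.
apply/eqP; apply: contraT => no_pd.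
suff /(_ 1%g)/eqP : forall w, pd_poly w = 0 by rewrite pd_poly1 oner_eq0.
apply: perm_ascent_ind => [|w i asc pd_ws].
  rewrite /pd_poly big_pred0 // => P; apply/negP => /eqP word_P.
  by move: no_pd; rewrite -(demazure_w0 word_P) word_P eqxx.
apply: (mulfI (mpolyX_sub_neq0 (sleft_neq_sright i))).
by rewrite pd_poly_rec // pd_ws msym0 !mulr0 subr0.
Qed.

Lemma pd_poly_w0 : pd_poly (w0 n) = (-1) ^+ ninv (w0 n) * Grothendieck n (w0 n).
Proof.
rewrite /pd_poly (big_pred1 (rothe (w0 n))) => [|P]; last first.
  by apply/eqP/eqP => [/demazure_w0 //|->]; rewrite demazure_rothe_w0.
rewrite cross_monomialE card_rothe Grothendieck_w0; congr (_ * _).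
rewrite mpolyXE_id; apply: eq_bigr => i _; rewrite mnmE; congr (_ ^+ _).
rewrite -(card_ord_lt (leq_subr i.+1 n)); apply: eq_card => k.
by rewrite [RHS]inE [LHS]inE rothe_w0 /=; lia.
Qed.

Lemma Grothendieck_pd_poly w : Grothendieck n w = (-1) ^+ ninv w * pd_poly w.
Proof.
move: w; apply: perm_ascent_ind => [|w i asc IH].
  by rewrite pd_poly_w0 mulrA -exprMn mulrNN mulr1 expr1n mul1r.
apply: (mulfI (mpolyX_sub_neq0 (sleft_neq_sright i))).
have sign_inv : msym (simple i) ((-1) ^+ ninv w : R) = (-1) ^+ ninv w by exact: rmorph_sign.
rewrite (Grothendieck_rec asc) ddiffE IH (ninv_asc asc) exprS mulN1r.
rewrite !msymM msymN sign_inv msymB msym1 msym_simpleR.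
transitivity ((-1) ^+ ninv w * (('X_(sleft i) - 'X_(sright i)) * pd_poly w)); last by ring.
by rewrite pd_poly_rec //; ring.
Qed.

End PipeDreamPolynomials.

Lemma exprz_sub_nat (a b : nat) : (-1 : int) ^ (a%:Z - b%:Z) = (-1) ^+ a * (-1) ^+ b.
Proof. by rewrite exprzDr ?unitrN1 // -exprz_inv invrN1. Qed.

Lemma card_imset_sep (aT rT : finType) (f : aT -> rT) (A : {set aT}) (p : pred rT) :
  {in A &, injective f} -> #|[set y in f @: A | p y]| = #|[set x in A | p (f x)]|.
Proof.
move=> f_inj.
have -> : [set y in f @: A | p y] = f @: [set x in A | p (f x)].
  apply/setP => y; rewrite inE; apply/andP/imsetP => [[/imsetP[x xA ->] px]|[x + ->]].
    by exists x; rewrite // inE xA.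
  by rewrite inE => /andP[xA px]; rewrite imset_f.
by apply: card_in_imset; apply: sub_in2 f_inj => x; rewrite inE => /andP[].
Qed.

Section TableauSums.
Variables (n : nat) (w : 'S_n).
Hypothesis avoidw : avoids321 w.

Lemma signed_term_tableau T : tableau (rothe w) T -> signed_term w (diagram_of T) =
  (-1) ^+ ninv w * cross_monomial (fun q => 'X_(q.1)) (pipe_dream w T).
Proof.
move=> tabT; rewrite cross_monomialE /signed_term coxlenE exprz_sub_nat !card_wt
  wt_pipe_dream //.
by rewrite -mul_mpolyC mulrA rmorphM !rmorphXn !rmorphN1 /= [X in X * _ = _]mulrC.
Qed.

Lemma Grothendieck_KKoh : Grothendieck n w = \sum_(D in KKoh (rothe w)) signed_term w D.
Proof.
rewrite Grothendieck_pd_poly /pd_poly -big_set pipe_dreams_tableaux //.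
rewrite (KKoh_tableaux (rothe_skew avoidw)) !big_imset /=; last first.
- exact: pipe_dream_inj.
- exact: diagram_of_inj.
by rewrite mulr_sumr; apply: eq_bigr => T; rewrite inE => tabT; rewrite signed_term_tableau.
Qed.

Lemma gcoef_KKoh gamma : gcoef w gamma = #|KKoh_wt w gamma|.
Proof.
have -> : gcoef w gamma =
    #|[set P in [set pipe_dream w T | T in tableaux (rothe w)] | wt P == gamma]|.
  by rewrite -pipe_dreams_tableaux //; apply: eq_card => P; rewrite !inE.
rewrite /KKoh_wt (KKoh_tableaux (rothe_skew avoidw)) !card_imset_sep.
- by apply: eq_card => T; rewrite !inE; case: (boolP (tableau _ T)) => // /wt_pipe_dream ->.
- exact: diagram_of_inj.
- exact: pipe_dream_inj.
Qed.

End TableauSums.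

Theorem theorem5p1 (n : nat) (w : 'S_n) (hw : avoids321 w) :
  (forall gamma : 'X_{1..n},
     gcoef w gamma = #|KKoh_wt w gamma| /\
     #|KKoh_wt w gamma| = #|tKKoh_wt w gamma|) /\
  (Grothendieck n w = \sum_(D in KKoh (rothe w)) signed_term w D /\
   \sum_(D in KKoh (rothe w)) signed_term w D
     = \sum_(D in tKKoh (rothe w)) signed_term w D).
Proof.
have tKKohE : tKKoh (rothe w) = KKoh (rothe w) := tKKoh_skew (rothe_skew hw).
split=> [gamma|]; last by rewrite tKKohE -Grothendieck_KKoh.
by rewrite gcoef_KKoh // /tKKoh_wt tKKohE.
Qed.
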